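(* Let $\mathcal{K}$ be a real Hilbert space, let $A\colon\mathcal{K}\to 2^{\mathcal{K}}$ be maximally monotone, let $\beta\in\left]0,+\infty\right[$, and let $B\colon\mathcal{K}\to\mathcal{K}$ be $\beta$-cocoercive. Assume that the set $\mathcal{P}=\{z\in\mathcal{K} : 0\in Az+Bz\}$ is nonempty. Let $U\colon\mathcal{K}\to\mathcal{K}$ be a bounded linear, self-adjoint and strongly positive operator. Let $\varepsilon\in\left]0,\min\{1,\beta\|U\|^{-1}\}\right[$, let $(\gamma_n)_{n\in\mathbb{N}}$ be a sequence in $\left[\varepsilon,(2-\varepsilon)\beta\|U\|^{-1}\right]$, and let $(\alpha_n)_{n\in\mathbb{N}}$ be a sequence in $\left[0,1-\varepsilon\right]$. Let $(r_n)_{n\in\mathbb{N}}$ be a $\mathcal{K}$-valued, square integrable random process, let $w_0$ be a $\mathcal{K}$-valued, square integrable random variable, and set $w_{-1}=w_0$. For every $n\in\mathbb{N}$, define $$z_n=w_n+\alpha_n(w_n-w_{n-1}),\qquad w_{n+1}=J_{\gamma_nUA}(z_n-\gamma_nUr_n),$$ and set $\mathcal{F}_n=\sigma(w_0,\ldots,w_n)$. Suppose that the following conditions are satisfied: 1. for every $n\in\mathbb{N}$, $\mathsf{E}[r_n\mid\mathcal{F}_n]=Bw_n$ a.s.; 2. $\sum_{n\in\mathbb{N}}\mathsf{E}[\|r_n-Bw_n\|^2\mid\mathcal{F}_n]<+\infty$ a.s.; 3. $\sup_{n\in\mathbb{N}}\|w_n-w_{n-1}\|<\infty$ a.s. and $\sum_{n\in\mathbb{N}}\alpha_n<+\infty$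 a.s. Then there exists a random variable $\overline{w}$, $\mathcal{P}$-valued a.s., such that the following hold: (i) $w_n\rightharpoonup\overline{w}$ a.s. (weak convergence in $\mathcal{K}$); (ii) $Bw_n\to B\overline{w}$ a.s. (strong convergence in $\mathcal{K}$); (iii) if $B$ is uniformly monotone at $\overline{w}$, then $\|w_n-\overline{w}\|\to0$ a.s.
   Context: All random variables are defined on a common probability space, and $\mathsf{E}[\cdot\mid\mathcal{F}]$ denotes conditional expectation; $\sigma(w_0,\ldots,w_n)$ is the sigma-algebra generated by $w_0,\ldots,w_n$. An operator $A\colon\mathcal{K}\to2^{\mathcal{K}}$ is monotone if $\langle v_1-v_2, z_1-z_2\rangle\ge0$ whenever $v_1\in Az_1$, $v_2\in Az_2$; it is maximally monotone if moreover no monotone operator has a graph properly containing the graph of $A$. $B\colon\mathcal{K}\to\mathcal{K}$ is $\beta$-cocoercive if $\langle z_1-z_2, Bz_1-Bz_2\rangle\ge\beta\|Bz_1-Bz_2\|^2$ for all $z_1,z_2\in\mathcal{K}$. A self-adjoint bounded linear operator $U$ is strongly positive if there is $\chi>0$ with $\langle Uz, z\rangle\ge\chi\|z\|^2$ for all $z\in\mathcal{K}$. For $\gamma>0$, $J_{\gamma UA}=(\mathrm{Id}+\gamma UA)^{-1}$ is the resolvent of $\gamma UA$; it is single-valued and everywhere defined because $UA$ is maximally monotone for the inner product $(x,y)\mapsto\langle U^{-1}x, y\rangle$. $B$ is uniformly monotone at $\overline{w}$ if there is an increasing function $\phi\colon[0,+\infty[\to[0,+\infty]$ vanishing only at $0$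 such that $\langle z-\overline{w}, Bz-B\overline{w}\rangle\ge\phi(\|z-\overline{w}\|)$ for all $z\in\mathcal{K}$ (when $\overline w$ is random, this is required almost surely). *)

(* Defs.v *)
From HB Require Import structures.
From mathcomp Require Import all_boot all_order all_algebra sesquilinear.
From mathcomp Require Import all_classical all_reals all_analysis.

Set Implicit Arguments.
Unset Strict Implicit.
Unset Printing Implicit Defensive.

Import Order.TTheory GRing.Theory Num.Theory.
Import numFieldNormedType.Exports.
Local Open Scope classical_set_scope.
Local Open Scope ring_scope.

(* A real Hilbert space is a completeNormedModType over a realType together
   with an inner product that induces its norm. *)
Definition induces_norm (R : realType) (K : normedModType R)
    (dot : {dot K for idfun}) : Prop :=
  forall x, `|x| ^+ 2 = dot x x.

Definition weakly_cvg (R : realType) (K : normedModType R)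
    (dot : {dot K for idfun}) (u : nat -> K) (l : K) : Prop :=
  forall v : K, dot (u n) v @[n --> \oo] --> dot l v.

Section operators.
Variables (R : realType) (K : normedModType R) (dot : {dot K for idfun}).

Definition monotone_operator (A : K -> set K) : Prop :=
  forall z1 z2 v1 v2, A z1 v1 -> A z2 v2 -> 0 <= dot (v1 - v2) (z1 - z2).

Definition maximally_monotone (A : K -> set K) : Prop :=
  monotone_operator A /\
  forall A' : K -> set K, monotone_operator A' ->
    (forall z, A z `<=` A' z) -> forall z, A' z `<=` A z.

Definition cocoercive (beta : R) (B : K -> K) : Prop :=
  forall z1 z2, beta * `|B z1 - B z2| ^+ 2 <= dot (z1 - z2) (B z1 - B z2).

(* The modulus phi is only constrained on [0, +oo[. *)
Definition uniformly_monotone_at (B : K -> K) (w : K) : Prop :=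
  exists phi : R -> \bar R,
    [/\ forall s t, 0 <= s -> s <= t -> (phi s <= phi t)%E,
        forall s, 0 <= s -> (0 <= phi s)%E,
        forall s, 0 <= s -> (phi s = 0%E <-> s = 0) &
        forall z : K, (phi `|z - w|%R <= (dot (z - w)%R (B z - B w)%R)%:E)%E].

Definition bounded_operator (U : K -> K) : Prop :=
  exists M : R, forall x, `|U x| <= M * `|x|.

Definition operator_norm (U : K -> K) : R :=
  sup [set `|U x| | x in [set x : K | `|x| <= 1]].

Definition self_adjoint (U : K -> K) : Prop :=
  forall x y, dot (U x) y = dot x (U y).

Definition strongly_positive (U : K -> K) : Prop :=
  exists2 chi : R, 0 < chi & forall z, chi * `|z| ^+ 2 <= dot (U z) z.

Definition zeros_of_sum (A : K -> set K) (B : K -> K) : set K :=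
  [set z | [set v + B z | v in A z] 0].

Definition inverse_operator (S : K -> set K) : K -> set K :=
  fun v => [set z | S z v].

Definition resolvent (S : K -> set K) : K -> set K :=
  inverse_operator (fun z => [set z + v | v in S z]).

Definition scaled_operator (gamma : R) (U : K -> K) (A : K -> set K) :
    K -> set K :=
  fun z => [set gamma *: U v | v in A z].

End operators.

Section bochner.
Variables (R : realType) (E : normedModType R).

(* Measurability with respect to the set system G in the sense of Bochner. The
   condition on the range is automatic when E is separable; without it, sums of
   Borel measurable maps need not be measurable. *)
Definition strongly_measurable (T : Type) (G : set (set T)) (X : T -> E) : Prop :=
  (forall O : set E, open O -> G (X @^-1` O)) /\
  exists2 D : set E, countable D & range X `<=` closure D.

(* The list [:: (A_1, c_1); ...; (A_m, c_m)] stands for the simple function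
   \1_A_1 c_1 + ... + \1_A_m c_m. *)
Definition simple_eval (T : Type) (s : seq (set T * E)) (t : T) : E :=
  \sum_(p <- s) \1_(p.1) t *: p.2.

Context d (T : measurableType d) (P : probability T R).

Definition simple_integral (A : set T) (s : seq (set T * E)) : E :=
  \sum_(p <- s) fine (P (A `&` p.1)) *: p.2.

Definition bochner_integrable (X : T -> E) : Prop :=
  strongly_measurable measurable X /\ (\int[P]_t `|X t|%:E < +oo)%E.

Definition square_integrable (X : T -> E) : Prop :=
  strongly_measurable measurable X /\ (\int[P]_t (`|X t| ^+ 2)%:E < +oo)%E.

(* v is the Bochner integral of X over A. *)
Definition is_bochner_integral (A : set T) (X : T -> E) (v : E) : Prop :=
  exists s : nat -> seq (set T * E),
    [/\ forall k p, p \in s k -> measurable p.1,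
        (\int[P]_(t in A) `|X t - simple_eval (s k) t|%:E)%E
          @[k --> \oo] --> 0%E &
        simple_integral A (s k) @[k --> \oo] --> v].

(* Y is a version of the conditional expectation of X given the sigma-algebra
   G. *)
Definition is_cond_exp (G : set (set T)) (X Y : T -> E) : Prop :=
  [/\ bochner_integrable X, bochner_integrable Y, strongly_measurable G Y &
      forall A, G A ->
        exists2 v, is_bochner_integral A X v & is_bochner_integral A Y v].

(* sigma(w_0, ..., w_n) *)
Definition natural_filtration (w : nat -> T -> E) (n : nat) : set (set T) :=
  <<s \bigcup_(i in [set i | (i <= n)%N])
        preimage_set_system setT (w i) (<<s [set O : set E | open O] >>) >>.

End bochner.

(* Main.v *)
Require Import Defs.
From HB Require Import structures.
From mathcomp Require Import all_boot all_order all_algebra sesquilinear.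
From mathcomp Require Import all_classical all_reals all_analysis.
From mathcomp Require Import measurable_realfun ring lra.

Set Implicit Arguments.
Unset Strict Implicit.
Unset Printing Implicit Defensive.

Import Order.TTheory GRing.Theory Num.Theory.
Import numFieldNormedType.Exports.
Local Open Scope classical_set_scope.
Local Open Scope ring_scope.

(** Why the theorem holds.

    Let [W] be the inverse of [U] and measure distances by
    [energy x = <W x, x>].  In this metric the resolvent of [gamma_n U A] is
    firmly nonexpansive and, because [gamma_n |U| <= (2 - eps) beta], the map
    [Id - gamma_n U B] is nonexpansive.  With [xi_n = r_n - B w_n] one therefore
    has, for every zero [z] of [A + B] and along every trajectory
    ([energy_decrease]),

      energy (w_(n+1) - z) + gain_n + 2 gamma_n <a_n, xi_n>
        <= (1 + alpha_n) energy (w_n - z) + C alpha_n |w_n - w_(n-1)|^2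
             + C |xi_n|^2,

    where [a_n] depends on the past only, and where the gain dominates
    [|B w_n - B z|^2], [|xi_n|^2] and the energy of the resolvent residual.
    The inertial term has been absorbed through
    [2 alpha <p, q> <= alpha (|p|^2 + |q|^2)].  Over an event of the past the
    term with [<a_n, xi_n>] integrates to zero ([integral_dot_eq0]), so that the
    energies form an almost supermartingale ([energy_drift]).

    The noise [xi_n] need not be measurable with respect to the sigma-algebra
    of time [n + 1], so the partial sums of the products with [a_n] need not be
    martingales; only the energies are adapted.  Their convergence is therefore
    derived from the Robbins-Siegmund theorem ([robbins_siegmund]), itself a
    consequence of Doob's upcrossing inequality for nonnegative supermartingales.
    Both are stated with inequalities between integrals of nonnegative functions
    over events of the past, which is the form in which the conditional
    expectations of the noise enter.

    Consequently, for each zero [z], almost surely the energy of [w_n - z]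
    converges and the gains are summable.  Along such a trajectory
    [w_n - w_(n+1) --> 0], [B w_n --> B z], and the resolvent selects
    [v_n] in [A w_(n+1)] with [v_n --> - B z]; since the graph of [A] is closed
    for weak limits of points and strong limits of images, every weak cluster
    point of [w_n] is a zero ([weak_limit_zero]), and Opial's lemma ([opial])
    gives weak convergence.

    The exceptional null set depends on [z], and the Hilbert space need not be
    separable.  But every [w_n] has a separable range, so the whole process
    lives in a separable closed subspace, and Opial's lemma only
    requires a countable family of zeros that is dense among the zeros of that
    subspace.  Separability also makes the weak limit strongly measurable
    ([approximable_weakly_measurable]). *)

(** * Inner products *)

Section inner_product.
Variables (R : realType) (K : normedModType R) (dot : {dot K for idfun}).
Hypothesis dot_norm : induces_norm dot.

Lemma dotC x y : dot x y = dot y x.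
Proof. by have := hermC dot x y; rewrite expr0 mul1r. Qed.

Lemma dotDl x y z : dot (x + y) z = dot x z + dot y z.
Proof. exact: linearDl. Qed.

Lemma dotZl a x z : dot (a *: x) z = a * dot x z.
Proof. exact: linearZl_LR. Qed.

Lemma dotNl x z : dot (- x) z = - dot x z.
Proof. exact: linearNl. Qed.

Lemma dotDr x y z : dot z (x + y) = dot z x + dot z y.
Proof. exact: linearDr. Qed.

Lemma dotZr a x z : dot z (a *: x) = a * dot z x.
Proof. exact: linearZr_LR. Qed.

Lemma dotNr x z : dot z (- x) = - dot z x.
Proof. exact: linearNr. Qed.

Definition dotE := (dotDl, dotDr, dotNl, dotNr, dotZl, dotZr).

Lemma dotxx x : dot x x = `|x| ^+ 2. Proof. by rewrite dot_norm. Qed.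

Lemma dot_le_norm x y : dot x y <= `|x| * `|y|.
Proof.
have : `|x + y| ^+ 2 <= (`|x| + `|y|) ^+ 2.
  by rewrite lerXn2r ?nnegrE ?addr_ge0 ?ler_normD.
by rewrite sqrrD -!dotxx !dotE (dotC y x) -mulr_natl; lra.
Qed.

Lemma abs_dot_le_norm x y : `|dot x y| <= `|x| * `|y|.
Proof.
by rewrite ler_norml dot_le_norm lerNl -dotNl -(normrN x) dot_le_norm.
Qed.

Lemma dot_bounded_op M (U : K -> K) x y :
  (forall x, `|U x| <= M * `|x|) -> dot (U x) y <= M * (`|x| * `|y|).
Proof.
move=> UM; apply: le_trans (dot_le_norm _ _) _.
by rewrite mulrA ler_wpM2r.
Qed.

(** The error [<f - a, g>] is absorbed by the bound on [g]; what remains is the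
    weak convergence of [g] tested against [a]. *)
Lemma cvg_dot_strong_weak (T : Type) (F : set_system T) {FF : Filter F}
    (f g : T -> K) (a b : K) (M : R) :
  f x @[x --> F] --> a -> (forall x, `|g x| <= M) ->
  (forall v, dot (g x) v @[x --> F] --> dot b v) ->
  dot (f x) (g x) @[x --> F] --> dot a b.
Proof.
move=> fa gM gb.
rewrite -[dot a b]add0r.
have -> : (fun x => dot (f x) (g x)) =
          (fun x => dot (f x - a) (g x) + dot (g x) a).
  by apply/funext => x; rewrite (dotC _ a) -dotDl subrK.
apply: cvgD; last by rewrite dotC; exact: gb.
apply/norm_cvg0P.
have fa0 : `|f x - a| * M @[x --> F] --> (0 : R).
  rewrite -[X in _ --> X](mul0r M); apply: cvgM; last exact: cvg_cst.
  by apply/norm_cvg0P; apply/subr_cvg0.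
apply: (squeeze_cvgr _ _ fa0); last exact: cvg_cst.
by apply: nearW => x; rewrite normr_ge0 (le_trans (abs_dot_le_norm _ _))// ler_wpM2l.
Qed.

Lemma cvg_dotl (T : Type) (F : set_system T) {FF : Filter F}
    (f : T -> K) (a b : K) :
  f x @[x --> F] --> a -> dot (f x) b @[x --> F] --> dot a b.
Proof.
move=> fa; apply: (@cvg_dot_strong_weak _ _ _ _ (fun=> b) _ _ `|b|) => //.
by move=> v; apply: cvg_cst.
Qed.

End inner_product.

Section symmetric_lax_milgram.
Variables (R : realType) (K : completeNormedModType R) (dot : {dot K for idfun}).
Hypothesis dot_norm : induces_norm dot.
Variables (U : {linear K -> K}) (chi : R) (L : set K).
Hypotheses (U_sa : self_adjoint dot U).
Hypotheses (chi_gt0 : 0 < chi) (U_pos : forall x, chi * `|x| ^+ 2 <= dot (U x) x).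
Hypotheses (L_closed : closed L) (L0 : L 0).
Hypothesis L_lin : forall s x y, L x -> L y -> L (x + s *: y).
Variables (l : K -> R) (C : R).
Hypothesis l_lin : forall s x y, l (x + s *: y) = l x + s * l y.
Hypothesis l_bounded : forall x, l x <= C * `|x|.

(** The quadratic functional [<U x, x> - 2 l x] is bounded below on [L].  By
    the parallelogram identity a minimising sequence is Cauchy, and its limit
    satisfies the Euler equation.  Taking [U] to be the identity gives the Riesz
    representation and the orthogonal projection on [L]; taking [L] to be the
    whole space gives the surjectivity of [U]. *)
Lemma symmetric_lax_milgram :
  exists2 x, L x & forall v, L v -> dot (U x) v = l v.
Proof.
pose q x := dot (U x) x; pose f x := q x - 2 * l x.
have f_ge x : - (C ^+ 2 / chi) <= f x.
  have := U_pos x; have := l_bounded x.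
  rewrite /f /q; set X := `|x| => lX qX.
  have : 0 <= chi * (X - C / chi) ^+ 2 by rewrite mulr_ge0 ?sqr_ge0// ltW.
  rewrite sqrrB.
  have -> : chi * (X ^+ 2 - X * (C / chi) *+ 2 + (C / chi) ^+ 2) =
            chi * X ^+ 2 - 2 * (C * X) + C ^+ 2 / chi.
    by field; rewrite gt_eqF.
  lra.
pose m := inf (f @` L).
have f_inf : has_inf (f @` L).
  split; first by exists (f 0), 0.
  by exists (- (C ^+ 2 / chi)) => _ [x _ <-].
have m_le x : L x -> m <= f x.
  by move=> Lx; apply: ge_inf; [case: f_inf|exists x].
have /choice [x xP] : forall n, exists x, L x /\ f x < m + n.+1%:R^-1.
  move=> n; have [|_ [x Lx <-] fx] := @inf_adherent _ _ (n.+1%:R^-1) _ f_inf.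
    by rewrite invr_gt0.
  by exists x.
have U_dot2 (u v : K) : dot (U u) v = dot (U v) u by rewrite U_sa dotC.
have fpert y s v : f (y + s *: v) =
    f y + 2 * s * (dot (U y) v - l v) + s ^+ 2 * q v.
  have U_lin : U (y + s *: v) = U y + s *: U v by rewrite linearD linearZ.
  by rewrite /f /q U_lin l_lin !dotE (U_dot2 v y); ring.
have mid y z : L y -> L z -> q (y - z) / 4 <= (f y + f z) / 2 - m.
  move=> Ly Lz.
  have Lyz : L (y + 2^-1 *: (z + (-1) *: y)) by exact/L_lin/L_lin.
  have := m_le _ Lyz.
  have -> : z + (-1) *: y = - (y - z) by rewrite scaleN1r opprB.
  set h := y - z => mf.
  have zE : f z = f (y + (-1) *: h) by rewrite scaleN1r opprB addrC subrK.
  have /eqP : f (y + 2^-1 *: - h) = (f y + f z) / 2 - q h / 4.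
    by rewrite zE scalerN -scaleNr !fpert; field.
  by move=> /eqP E; rewrite E in mf; lra.
have x_cvg : cvg (x @ \oo).
  apply: cauchy_cvg; apply: cauchy_exP => e e0.
  have e2 : 0 < chi * e ^+ 2 / 4 by rewrite divr_gt0 ?mulr_gt0 ?exprn_gt0.
  have [N _ HN] := near_infty_natSinv_lt (PosNum e2).
  exists (x N); exists N => // n /= Nn.
  rewrite -ball_normE /=.
  have [LN fN] := xP N; have [Ln fn] := xP n.
  have /= HNN := HN N (leqnn _); have /= Hn := HN n Nn.
  have := mid _ _ LN Ln; have := U_pos (x N - x n).
  rewrite -ltr_sqr ?nnegrE ?(ltW e0)// => h1 h2.
  rewrite -(ltr_pM2l chi_gt0); apply: le_lt_trans h1 _.
  rewrite -/(q _); move: (q _) h2 fN fn HNN Hn => b h2.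
  move: (f (x N)) (f (x n)) (N.+1%:R^-1) (n.+1%:R^-1) h2 => ? ? ? ?; lra.
exists (lim (x @ \oo)).
  by apply: (@closed_cvg _ _ \oo _ x L) => //; apply: nearW => n; case: (xP n).
move=> v Lv.
have euler s : 0 <= 2 * s * (dot (U (lim (x @ \oo))) v - l v) + s ^+ 2 * q v.
  have cv : 2 * s * (dot (U (x n)) v - l v) + s ^+ 2 * q v + n.+1%:R^-1
      @[n --> \oo] --> 2 * s * (dot (U (lim (x @ \oo))) v - l v) + s ^+ 2 * q v + 0.
    apply: cvgD; last exact: cvg_harmonic.
    apply: cvgD; last exact: cvg_cst.
    apply: cvgM; first exact: cvg_cst.
    apply: cvgB; last exact: cvg_cst.
    rewrite (U_sa (lim _)); under eq_fun do rewrite U_sa.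
    exact: cvg_dotl.
  rewrite addr0 in cv; apply: (cvgr_to_ge cv); apply: nearW => n.
  have [Ln fn] := xP n; have := m_le _ (L_lin s Ln Lv); rewrite fpert.
  by move: fn; move: (f (x n)) (q v) (n.+1%:R^-1) => ? ? ?; lra.
set g := dot _ _ - _ in euler.
have q0 : 0 <= q v by apply: le_trans (U_pos v); rewrite mulr_ge0 ?exprn_ge0// ltW.
have q1 : 0 < q v + 1 by lra.
(* A minimiser of [2 s g + s^2 q v] is [- g / q v]; the shift by one avoids the
   case [q v = 0]. *)
have := euler (- g / (q v + 1)).
have -> : 2 * (- g / (q v + 1)) * g + (- g / (q v + 1)) ^+ 2 * q v =
   - (g ^+ 2 * ((q v + 2) / (q v + 1) ^+ 2)) by field; rewrite gt_eqF.
rewrite oppr_ge0 pmulr_lle0; last by rewrite divr_gt0 ?exprn_gt0//; lra.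
rewrite real_exprn_even_le0 ?num_real//= => /eqP g0.
by apply/eqP; rewrite -subr_eq0 -/g g0.
Qed.

End symmetric_lax_milgram.

(** The last bound is [<U y, y> >= chi |y|^2] for [y = W x], combined with
    [|x| <= M |y|]. *)
Lemma strongly_positive_inverse (R : realType) (K : completeNormedModType R)
    (dot : {dot K for idfun}) (dot_norm : induces_norm dot)
    (U : {linear K -> K}) (M chi : R) :
  (forall x, `|U x| <= M * `|x|) -> self_adjoint dot U -> 0 < M -> 0 < chi ->
  (forall x, chi * `|x| ^+ 2 <= dot (U x) x) ->
  exists W : {linear K -> K},
    [/\ cancel W U, cancel U W, self_adjoint dot W,
        forall x, `|W x| <= chi^-1 * `|x| &
        forall x, chi / M ^+ 2 * `|x| ^+ 2 <= dot (W x) x].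
Proof.
move=> U_bounded U_sa M0 chi0 U_pos.
have /choice [W UW] : forall y, exists x, U x = y.
  move=> y.
  have [||x _ xP] := @symmetric_lax_milgram _ _ _ dot_norm U chi setT
    U_sa chi0 U_pos closedT I (fun _ _ _ _ _ => I) (dot y) `|y|.
  - by move=> s u v; rewrite !dotE.
  - by move=> u; exact: dot_le_norm.
  exists x; apply/eqP; rewrite -subr_eq0 -normr_eq0 -sqrf_eq0 dot_norm.
  by rewrite dotDl dotNl xP// subrr.
have U_inj : injective U.
  move=> x y Uxy; apply/eqP; rewrite -subr_eq0 -normr_eq0 -sqrf_eq0.
  have Uxy0 : U (x - y) = 0 by rewrite linearB/= Uxy subrr.
  have := U_pos (x - y); rewrite Uxy0 (linear0l dot).
  by rewrite pmulr_rle0// => h; rewrite eq_le h exprn_ge0.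
have W_lin : linear W by move=> a x y; apply: U_inj; rewrite linearP !UW.
pose W' : {linear K -> K} := HB.pack W (GRing.isLinear.Build R K K *:%R W W_lin).
exists W'; split => //=.
- by move=> x; apply: U_inj; rewrite UW.
- by move=> x y; rewrite -{1}(UW y) -U_sa UW.
- move=> x; have := U_pos (W x); rewrite UW => h.
  have := le_trans h (dot_le_norm dot_norm _ _); rewrite expr2 mulrA.
  have [->|Wx0] := eqVneq (W x) 0; first by rewrite normr0 mulr_ge0 ?invr_ge0// ltW.
  by rewrite ler_pM2r ?normr_gt0// mulrC -ler_pdivlMr// mulrC.
- move=> x; rewrite -{3}(UW x) dotC; apply: le_trans (U_pos _).
  rewrite -mulrA ler_pM2l// mulrC ler_pdivrMr ?exprn_gt0// mulrC -exprMn.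
  by rewrite lerXn2r ?nnegrE ?mulr_ge0 ?(ltW M0)// -{1}(UW x).
Qed.

(** * Weak convergence *)

Section weak_convergence.
Variables (R : realType) (K : completeNormedModType R) (dot : {dot K for idfun}).
Hypothesis dot_norm : induces_norm dot.

Let id_sa : self_adjoint dot idfun. Proof. by []. Qed.

Let id_pos : forall x : K, 1 * `|x| ^+ 2 <= dot (idfun x) x.
Proof. by move=> x; rewrite mul1r dot_norm. Qed.

Lemma ultra_bounded_cvg (J : Type) (F : set_system J) (f : J -> R) (M : R) :
  UltraFilter F -> (forall i, `|f i| <= M) -> cvg (f i @[i --> F]).
Proof.
move=> FU fM; have FF : ProperFilter F by case: FU.
have F1 : (f i @[i --> F]) [set` `[- M, M]].
  by apply: nearW => i /=; rewrite in_itv/= -ler_norml.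
have [p [_ pcl]] := segment_compact _ F1.
apply/cvg_ex; exists p => A Ap.
have [//|FA] := in_ultra_setVsetC (f @^-1` A) FU.
by have [x []] := pcl (~` A) A FA Ap.
Qed.

(** Along an ultrafilter the bounded reals [<u i, v>] converge for every [v];
    the limit is a bounded linear functional of [v], which the Riesz theorem
    represents. *)
Lemma ultra_weak_cluster (J : Type) (F : set_system J) (u : J -> K) (M : R) :
  UltraFilter F -> (forall i, `|u i| <= M) ->
  exists l, forall v, dot (u i) v @[i --> F] --> dot l v.
Proof.
move=> FU uM; have FF : ProperFilter F by case: FU.
have uc v : cvg (dot (u i) v @[i --> F]).
  apply: (@ultra_bounded_cvg _ _ _ (M * `|v|)) => // i.
  by rewrite (le_trans (abs_dot_le_norm _ _ _))// ler_wpM2r.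
have [||l _ lP] := @symmetric_lax_milgram _ _ _ dot_norm idfun 1 setT
  id_sa ltr01 id_pos closedT I (fun _ _ _ _ _ => I)
  (fun v => lim (dot (u i) v @[i --> F])) M.
- move=> s x y; apply: cvg_lim => //; under eq_fun do rewrite !dotE.
  by apply: cvgD; [exact: uc|apply: cvgM; [exact: cvg_cst|exact: uc]].
- move=> x; apply: limr_le; first exact: uc.
  by apply: nearW => i; rewrite (le_trans (dot_le_norm _ _ _))// ler_wpM2r.
- by exists l => v; rewrite lP//; exact: uc.
Qed.

(** Let [p] be the projection of the weak limit [l] on [L].  Then [l - p] is
    orthogonal to [L], hence to [p] and, in the limit, to [l] itself, so that it
    vanishes. *)
Lemma weak_limit_closed_subspace (J : Type) (F : set_system J) (L : set K)
    (u : J -> K) (l : K) :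
  ProperFilter F -> closed L -> L 0 ->
  (forall s x y, L x -> L y -> L (x + s *: y)) -> (forall i, L (u i)) ->
  (forall v, dot (u i) v @[i --> F] --> dot l v) -> L l.
Proof.
move=> FF Lc L0 Ll Lu ul.
have [||p Lp pP] := @symmetric_lax_milgram _ _ _ dot_norm idfun 1 L
  id_sa ltr01 id_pos Lc L0 Ll (dot l) `|l|.
- by move=> s x y; rewrite !dotE.
- by move=> x; exact: dot_le_norm.
suff -> : l = p by [].
apply/eqP; rewrite -subr_eq0 -normr_eq0 -sqrf_eq0 dot_norm.
have orth v : L v -> dot v (l - p) = 0.
  by move=> Lv; rewrite dotC !dotE -(pP v Lv) subrr.
rewrite {1}dotDl dotNl (orth p)// subr0.
have /cvg_unique : dot (u i) (l - p) @[i --> F] --> (0 : R).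
  by under eq_fun do rewrite orth//; exact: cvg_cst.
by move=> /(_ (@norm_hausdorff _ _) _ (ul _)) <-.
Qed.

(** Opial's lemma.  Two weak cluster points [l1], [l2] cannot be distinguished by
    the functionals [<., W (zeta i - zeta j)>], hence by density
    [<W (l1 - l2), .>] is constant on [S], which contains both. *)
Lemma opial (u : nat -> K) (M : R) (W : {linear K -> K}) (S : set K)
    (zeta : nat -> K) :
  (forall n, `|u n| <= M) -> self_adjoint dot W ->
  (forall x, dot (W x) x = 0 -> x = 0) -> S `<=` closure (range zeta) ->
  (forall F l, ProperFilter F -> \oo `<=` F ->
    (forall v, dot (u n) v @[n --> F] --> dot l v) -> S l) ->
  (forall i j, cvg (dot (u n) (W (zeta i - zeta j)) @[n --> \oo])) ->
  exists2 l, S l & weakly_cvg dot u l.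
Proof.
move=> uM W_sa W_def SZ clu zc.
have uniq F1 F2 l1 l2 : ProperFilter F1 -> ProperFilter F2 ->
    \oo `<=` F1 -> \oo `<=` F2 ->
    (forall v, dot (u n) v @[n --> F1] --> dot l1 v) ->
    (forall v, dot (u n) v @[n --> F2] --> dot l2 v) -> l1 = l2.
  move=> FF1 FF2 F1o F2o ul1 ul2.
  have S1 := clu _ _ FF1 F1o ul1; have S2 := clu _ _ FF2 F2o ul2.
  pose c := dot (W (l1 - l2)).
  have c_zeta i : c (zeta i) = c (zeta 0%N).
    apply/eqP; rewrite -subr_eq0 /c -dotNr -dotDr W_sa dotDl dotNl subr_eq0.
    apply/eqP; have zi := zc i 0%N.
    rewrite -(cvg_unique (@norm_hausdorff _ _) (cvg_trans (cvg_app _ F1o) zi) (ul1 _)).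
    by rewrite -(cvg_unique (@norm_hausdorff _ _) (cvg_trans (cvg_app _ F2o) zi) (ul2 _)).
  have c_closure x : closure (range zeta) x -> c x = c (zeta 0%N).
    move=> xz; apply/eqP; rewrite -subr_eq0 -normr_eq0; apply/eqP.
    apply: le_anti; rewrite normr_ge0 andbT; apply/ler_addgt0Pr => e e0.
    rewrite add0r.
    pose N := `|W (l1 - l2)| + 1.
    have N0 : 0 < N by rewrite ltr_wpDl.
    have [|_ [[i _ <-] xi]] := xz (ball x (e / N)).
      by apply: nbhsx_ballx; rewrite divr_gt0.
    rewrite -(c_zeta i) /c -dotNr -dotDr (le_trans (abs_dot_le_norm _ _ _))//.
    move: xi; rewrite -ball_normE/= => /ltW xi.
    apply: le_trans (_ : N * (e / N) <= _); last by rewrite mulrC divfK ?gt_eqF.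
    by rewrite ler_pM// /N lerDl.
  apply/eqP; rewrite -subr_eq0; apply/eqP; apply: W_def; rewrite -/(c _).
  by rewrite /c dotDr dotNr -!/(c _) !c_closure ?subrr//; exact: SZ.
have [G [GU Goo]] := ultraFilterLemma (@eventually_filter).
have GF : ProperFilter G by case: GU.
have [l lP] := ultra_weak_cluster GU uM.
exists l; first exact: clu lP.
move=> v; apply/cvgrPdist_lt => e e0; apply: contrapT => noe.
(* If convergence fails for [v], some ultrafilter finer than [\oo] avoids the
   neighbourhoods of [dot l v], although its weak limit has to be [l]. *)
pose A := [set n | ~ `|dot l v - dot (u n) v| < e].
have wP : ProperFilter (within A \oo).
  apply: Build_ProperFilter => wB; apply: noe; apply: (@filterS _ \oo _ _ _ _ wB) => n An.
  exact: contrapT.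
have [G' [GU' Goo']] := ultraFilterLemma wP.
have GF' : ProperFilter G' by case: GU'.
have G'oo : \oo `<=` G'.
  by move=> B oB; apply: Goo'; rewrite /within/=; apply: filterS oB.
have [l' lP'] := ultra_weak_cluster GU' uM.
have ll : l' = l by apply: (uniq G' G).
have GA : G' A by apply: Goo'; rewrite /within /=; exact: nearW.
have /cvgrPdist_lt /(_ e e0) Ge := lP' v.
have [n [/= An]] := @filter_ex _ _ GF' _ (filterI GA Ge).
by rewrite ll.
Qed.

End weak_convergence.

(** * Strongly measurable maps *)

Lemma continuous_preimage_measurable (R : realType) (E : normedModType R) d
    (T : measurableType d) (X : T -> E) (f : E -> R) :
  (forall O, open O -> measurable (X @^-1` O)) -> continuous f ->
  measurable_fun setT (fun t => f (X t)).
Proof.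
move=> mX /continuousP cf.
apply: (measurability _ (RGenOInfty.measurableE R)) => _ [_ [a ->] <-].
rewrite setTI (_ : _ @^-1` _ = X @^-1` (f @^-1` [set` `]a, +oo[])) //.
by apply: mX; apply: cf; exact: interval_open.
Qed.

(** One point of [S] is chosen in each ball of radius [1 / (k + 1)] around a
    point of [D], whenever there is one; [y] is a default value. *)
Lemma separable_subset (R : realType) (E : normedModType R) (D S : set E) (y : E) :
  countable D -> S `<=` closure D ->
  exists x : nat -> E, (forall j, x j = y \/ S (x j)) /\
    forall s (e : R), S s -> 0 < e -> exists j, `|s - x j| < e.
Proof.
move=> /pfcard_geP[D0|[g]] SD.
  exists (fun=> y); split=> [|s e /SD Ds]; first by left.
  by move: Ds; rewrite D0 closure0.
have gD n : D (g n) by exact: (@funS _ _ _ _ g).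
have gsurj u : D u -> exists n, g n = u.
  by move=> /(@surj _ _ _ _ g)[n _ <-]; exists n.
pose near_g jk s := S s /\ `|s - g jk.1| < jk.2.+1%:R^-1.
have /choice [x xP] : forall n, exists s, (s = y \/ S s) /\
    forall jk, unpickle n = Some jk -> (exists s', near_g jk s') -> near_g jk s.
  move=> n; case: (unpickle n) => [jk|]; last by exists y; split; [left|].
  have [[s js]|no] := pselect (exists s', near_g jk s').
    by exists s; split => [|_ [<-]]; first by right; case: js.
  by exists y; split => [|_ [<-]]; first by left.
exists x; split; first by move=> n; case: (xP n).
move=> s e Ss e0.
have e20 : 0 < e / 2 by rewrite divr_gt0.
have [k _ kP] := near_infty_natSinv_lt (PosNum e20).
have /= ke := kP k (leqnn _).
have [|u [/gsurj[j jE]]] := SD _ Ss (ball s k.+1%:R^-1).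
  by apply: nbhsx_ballx; rewrite invr_gt0.
rewrite -ball_normE/= -jE => sj.
have njk : exists s', near_g (j, k) s' by exists s.
have [_ /(_ (j, k) (pickleK _) njk)[_ /= xj]] := xP (pickle (j, k)).
exists (pickle (j, k)).
rewrite -(subrKA (g j)) (le_lt_trans (ler_normD _ _))//.
by rewrite (distrC (g j)) (splitr e) ltrD// ?(lt_trans sj)// (lt_trans xj).
Qed.

Section approximable.
Variables (R : realType) (d : measure_display) (T : measurableType d).

(** Uniform approximability by maps taking countably many values.  This is
    equivalent to strong measurability, but visibly stable under maps that are
    Lipschitz in several strongly measurable variables, without any appeal to
    the open sets of a product. *)
Definition approximable (E : normedModType R) (X : T -> E) :=
  forall e : R, 0 < e -> exists (N : T -> nat) (x : nat -> E),
    measurable_fun setT N /\ forall t, `|X t - x (N t)| < e.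

Lemma approximable_of_dense (E : normedModType R) (X : T -> E) (x : nat -> E) :
  (forall j e, 0 < e -> measurable [set t | `|X t - x j| < e]) ->
  (forall t (e : R), 0 < e -> exists j, `|X t - x j| < e) -> approximable X.
Proof.
move=> mX xd e e0.
pose N t := ex_minn (xd t e e0).
exists N, x; split; last by move=> t; rewrite /N; case: ex_minnP.
move=> _ Y _; rewrite setTI.
pose A j := [set t | `|X t - x j| < e].
have -> : N @^-1` Y = \bigcup_(j in Y) (A j `\` \bigcup_(i in `I_j) A i).
  apply/seteqP; split => t.
    move=> YN; exists (N t) => //; rewrite /N.
    case: ex_minnP => n xn nmin; split => // -[i /= ni].
    by move=> /nmin; rewrite leqNgt ni.
  move=> [j Yj] [/= xj nj] /=.
  rewrite /N; case: ex_minnP => n xn nmin.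
  suff -> : n = j by [].
  apply/eqP; rewrite eqn_leq nmin//= leqNgt; apply/negP => nltj.
  by apply: nj; exists n.
apply: bigcup_measurable => j _; apply: measurableD; first exact: mX.
by apply: bigcup_measurable => k _; exact: mX.
Qed.

Lemma approximable_strongly_measurable (E : normedModType R) (X : T -> E) :
  approximable X -> strongly_measurable measurable X.
Proof.
move=> Xa.
have /choice [N /choice [x xP]] : forall k : nat, exists N, exists x : nat -> E,
    measurable_fun setT N /\ forall t, `|X t - x (N t)| < k.+1%:R^-1.
  by move=> k; apply: Xa; rewrite invr_gt0.
split.
  move=> O Oo.
  have -> : X @^-1` O = \bigcup_k ((N k) @^-1`
      [set j | ball (x k j) k.+1%:R^-1 `<=` O]).
    apply/seteqP; split => t.
      move=> /= Xt; have /nbhs_ballP[r /= r0 rO] : nbhs (X t) O by exact: open_nbhs_nbhs.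
      have r20 : 0 < r / 2 by rewrite divr_gt0.
      have [k _ kP] := near_infty_natSinv_lt (PosNum r20).
      have /= kr := kP k (leqnn _).
      exists k => // u /= uk; apply: rO; move: uk; rewrite -!ball_normE /= => uk.
      rewrite -(subrKA (x k (N k t))) (le_lt_trans (ler_normD _ _))//.
      have [_ /(_ t) xk] := xP k.
      by rewrite (splitr r) ltrD// (lt_trans _ kr).
    move=> [k _] /=; apply; rewrite -ball_normE/= distrC.
    by have [_ ->] := xP k.
  apply: bigcupT_measurable => k; have [mN _] := xP k.
  by rewrite -[X in measurable X]setTI; apply: mN.
exists [set x p.1 p.2 | p in [set: nat * nat]].
  by apply: sub_countable (card_image_le _ _) _; exact: countableP.
move=> _ [t _ <-] B /nbhs_ballP[r /= r0 rB].
have [k _ kP] := near_infty_natSinv_lt (PosNum r0).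
have /= kr := kP k (leqnn _).
exists (x k (N k t)); split; first by exists (k, N k t).
apply: rB; rewrite -ball_normE /=; have [_ /(_ t) xk] := xP k.
exact: lt_trans xk kr.
Qed.

Lemma strongly_measurable_approximable (E : normedModType R) (X : T -> E) :
  strongly_measurable measurable X -> approximable X.
Proof.
move=> [mX [D Dc XD]].
have [x [_ xP]] := separable_subset 0 Dc XD.
apply: (@approximable_of_dense _ _ x) => [j e e0|t e e0].
  rewrite (_ : [set t | _] = X @^-1` (ball (x j) e)); first exact/mX/ball_open.
  by apply/seteqP; split => t /=; rewrite -ball_normE/= distrC.
by apply: xP => //; exists t.
Qed.

(** On a level set of the pair of approximating indices [X] and [Y], hence also
    [Z], vary little, so that any value taken by [Z] there approximates it. *)
Lemma approximable_lipschitz2 (E1 E2 E3 : normedModType R) (X : T -> E1)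
    (Y : T -> E2) (Z : T -> E3) (L : R) :
  approximable X -> approximable Y ->
  (forall t t', `|Z t - Z t'| <= L * (`|X t - X t'| + `|Y t - Y t'|)) ->
  approximable Z.
Proof.
move=> Xa Ya ZL e e0.
pose r := e / (4 * (`|L| + 1)).
have L10 : 0 < `|L| + 1 by rewrite ltr_wpDl.
have r0 : 0 < r by rewrite divr_gt0// mulr_gt0.
have [N1 [x [mN1 xP]]] := Xa r r0; have [N2 [y [mN2 yP]]] := Ya r r0.
pose N t := pickle (N1 t, N2 t).
have mN : measurable_fun setT N.
  move=> _ B _; rewrite setTI.
  have -> : N @^-1` B = \bigcup_i \bigcup_(j in [set j | B (pickle (i, j))])
      (N1 @^-1` [set i] `&` N2 @^-1` [set j]).
    apply/seteqP; split => t.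
      by move=> Bt; exists (N1 t) => //; exists (N2 t).
    by move=> [i _ [j Bij []]] /=; rewrite /N => -> ->.
  apply: bigcupT_measurable => i; apply: bigcup_measurable => j _.
  apply: measurableI; rewrite -[X in measurable X]setTI.
    exact: mN1.
  exact: mN2.
have /choice [z zP] : forall k, exists u, (exists t, N t = k) ->
    exists2 t, N t = k & u = Z t.
  move=> k; have [[t <-]|no] := pselect (exists t, N t = k).
    by exists (Z t) => _; exists t.
  by exists 0.
exists N, z; split => // t.
have [|t' Nt' ->] := zP (N t); first by exists t.
have [N1E N2E] : N1 t' = N1 t /\ N2 t' = N2 t.
  by have /(pcan_inj pickleK)[-> ->] := Nt'.
have Xt : `|X t - X t'| < r + r.
  rewrite -(subrKA (x (N1 t))) (le_lt_trans (ler_normD _ _))// ltrD//.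
  by rewrite distrC -N1E.
have Yt : `|Y t - Y t'| < r + r.
  rewrite -(subrKA (y (N2 t))) (le_lt_trans (ler_normD _ _))// ltrD//.
  by rewrite distrC -N2E.
apply: le_lt_trans (ZL _ _) _.
have le1 : L * (`|X t - X t'| + `|Y t - Y t'|) <=
    (`|L| + 1) * (`|X t - X t'| + `|Y t - Y t'|).
  by rewrite ler_wpM2r ?addr_ge0// (le_trans (ler_norm _))// lerDl.
apply: le_lt_trans le1 _.
have -> : e = (`|L| + 1) * ((r + r) + (r + r)).
  by rewrite /r; field; rewrite gt_eqF.
by rewrite ltr_pM2l// ltrD.
Qed.

Lemma approximable_lipschitz (E1 E2 : normedModType R) (X : T -> E1)
    (Z : T -> E2) (L : R) :
  approximable X -> (forall t t', `|Z t - Z t'| <= L * `|X t - X t'|) ->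
  approximable Z.
Proof.
move=> Xa ZL; apply: (approximable_lipschitz2 (L := `|L|) Xa Xa) => t t'.
apply: le_trans (ZL t t') _.
have LL := ler_norm L; have X0 := normr_ge0 (X t - X t').
apply: (@le_trans _ _ (`|L| * `|X t - X t'|)); first by rewrite ler_wpM2r.
by rewrite ler_wpM2l// lerDl.
Qed.

Lemma approximable_cst (E : normedModType R) (c : E) : approximable (fun=> c).
Proof.
move=> e e0; exists (fun=> 0%N), (fun=> c).
by split => [|t]; [exact: measurable_cst|rewrite subrr normr0].
Qed.

Lemma approximableD (E : normedModType R) (X Y : T -> E) :
  approximable X -> approximable Y -> approximable (fun t => X t + Y t).
Proof.
move=> Xa Ya; apply: (approximable_lipschitz2 (L := 1) Xa Ya) => t t'.
by rewrite mul1r opprD addrACA ler_normD.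
Qed.

Lemma approximableZ (E : normedModType R) (a : R) (X : T -> E) :
  approximable X -> approximable (fun t => a *: X t).
Proof.
move=> Xa; apply: (approximable_lipschitz (L := `|a|) Xa) => t t'.
by rewrite -scalerBr normrZ.
Qed.

Lemma approximableB (E : normedModType R) (X Y : T -> E) :
  approximable X -> approximable Y -> approximable (fun t => X t - Y t).
Proof.
move=> Xa Ya; apply: approximableD => //.
by under eq_fun do rewrite -scaleN1r; exact: approximableZ.
Qed.

Lemma approximable_continuous_measurable (E : normedModType R) (X : T -> E)
    (f : E -> R) :
  approximable X -> continuous f -> measurable_fun setT (fun t => f (X t)).
Proof.
move=> /approximable_strongly_measurable [mX _].
exact: continuous_preimage_measurable.
Qed.

Lemma approximable_norm (E : normedModType R) (X : T -> E) :
  approximable X -> measurable_fun setT (fun t => `|X t|).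
Proof.
by move=> Xa; apply: approximable_continuous_measurable Xa _; exact: norm_continuous.
Qed.

Lemma approximable_dot (K : normedModType R) (dot : {dot K for idfun})
    (X Y : T -> K) : induces_norm dot ->
  approximable X -> approximable Y -> measurable_fun setT (fun t => dot (X t) (Y t)).
Proof.
move=> dot_norm Xa Ya.
have -> : (fun t => dot (X t) (Y t)) =
    (fun t => 4^-1 * (`|X t + Y t| ^+ 2 - `|X t - Y t| ^+ 2)).
  by apply/funext => t; rewrite !dot_norm !dotE (dotC _ (Y t)); field.
apply: (@measurable_funM _ _ R setT (fun=> 4^-1)
  (fun t => `|X t + Y t| ^+ 2 - `|X t - Y t| ^+ 2)); first exact: measurable_cst.
by apply: measurable_funB; apply: measurable_funX; apply: approximable_norm;
  [exact: approximableD|exact: approximableB].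
Qed.

End approximable.

(** * Bochner integrals and bounded functionals *)

Section bochner_integral.
Variables (R : realType) (E : normedModType R).
Context d (T : measurableType d) (P : probability T R).

Lemma approximable_indic (A : set T) (c : E) :
  measurable A -> approximable (fun t => \1_A t *: c).
Proof.
move=> mA e e0; exists (fun t => (t \in A) : nat), (fun n => n%:R *: c); split.
  apply: (measurableT_comp (f := fun b : bool => b : nat)).
    by move=> _ B _.
  by apply: (@measurable_fun_bool _ _ _ _ true) => //; rewrite preimage_true setTI set_mem_set.
by move=> t; rewrite indicE subrr normr0.
Qed.

Lemma approximable_simple (s : seq (set T * E)) :
  (forall p, p \in s -> measurable p.1) -> approximable (simple_eval s).
Proof.
elim: s => [|p s IH] ms.
  rewrite (_ : simple_eval _ = fun=> 0); first exact: approximable_cst.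
  by apply/funext => t; rewrite /simple_eval big_nil.
rewrite (_ : simple_eval _ = fun t => \1_(p.1) t *: p.2 + simple_eval s t).
  apply: approximableD; first by apply/approximable_indic/ms; rewrite mem_head.
  by apply: IH => q qs; apply: ms; rewrite in_cons qs orbT.
by apply/funext => t; rewrite /simple_eval big_cons.
Qed.

Variables (l : E -> R) (C : R).
Hypothesis l_lin : forall a x y, l (a *: x + y) = a * l x + l y.
Hypothesis l_bounded : forall x, `|l x| <= C * `|x|.

Let l0 : l 0 = 0.
Proof.
have := l_lin 1 0 0; rewrite scale1r addr0 mul1r => /eqP.
by rewrite -subr_eq subrr => /eqP.
Qed.

Let lB x y : l (x - y) = l x - l y.
Proof. by rewrite addrC -scaleN1r l_lin mulN1r addrC. Qed.

Let C_ge0 (x : E) : 0 <= C * `|x|.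
Proof. exact: le_trans (l_bounded x). Qed.

Let l_measurable (X : T -> E) : approximable X ->
  measurable_fun setT (fun t => l (X t)).
Proof.
move=> Xa; have : approximable (E := R^o) (fun t => l (X t)).
  apply: (approximable_lipschitz (L := C) Xa) => t t'.
  by rewrite -[X in `|X|]lB.
move=> /(approximable_continuous_measurable (f := fun x : R^o => (x : R))).
by apply => x; exact: cvg_id.
Qed.

Lemma bochner_integrable_functional (X : T -> E) : bochner_integrable P X ->
  P.-integrable setT (fun t => (l (X t))%:E).
Proof.
move=> [mX Xi]; have Xa := strongly_measurable_approximable mX.
apply: (@le_integrable _ _ _ _ _ measurableT _ (fun t => (C * `|X t|)%:E)).
- by apply/measurable_EFinP; exact: l_measurable.
- by move=> t _ /=; rewrite lee_fin (ger0_norm (C_ge0 _)).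
- under eq_fun do rewrite EFinM.
  apply: integrableZl => //; apply/integrableP; split.
    by apply/measurable_EFinP; exact: approximable_norm.
  by under eq_integral do rewrite /= normr_id.
Qed.

Let integrable_simple (s : seq (set T * E)) (A : set T) : measurable A ->
  (forall p, p \in s -> measurable p.1) ->
  P.-integrable A (fun t => (l (simple_eval s t))%:E) /\
  (\int[P]_(t in A) (l (simple_eval s t))%:E = (l (simple_integral P A s))%:E)%E.
Proof.
move=> mA; elim: s => [|p s IH] ms.
  split.
    rewrite (_ : (fun t => _) = cst 0%E); first exact: integrable0.
    by apply/funext => t; rewrite /simple_eval big_nil l0.
  rewrite integral0_eq ?/simple_integral ?big_nil ?l0//.
  by move=> t _; rewrite /simple_eval big_nil l0.
have [|si sE] := IH; first by move=> q qs; apply: ms; rewrite in_cons qs orbT.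
have mp : measurable p.1 by apply: ms; rewrite mem_head.
have pi : P.-integrable A (fun t => (l p.2)%:E * (\1_(p.1) t)%:E)%E.
  apply: integrableZl => //; apply: (@integrableS _ _ _ _ setT) => //.
  exact: integrable_indic.
have E1 : (fun t => (l (simple_eval (p :: s) t))%:E) =
    (fun t => (l p.2)%:E * (\1_(p.1) t)%:E + (l (simple_eval s t))%:E)%E.
  by apply/funext => t; rewrite /simple_eval big_cons l_lin EFinD EFinM muleC.
rewrite E1; split; first exact: integrableD.
rewrite integralD// sE /simple_integral big_cons l_lin EFinD; congr (_ + _)%E.
rewrite integralZl//; last first.
  apply: (@integrableS _ _ _ _ setT) => //; exact: integrable_indic.
rewrite integral_indic// EFinM muleC setIC fineK// fin_num_measure//.
exact: measurableI.
Qed.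

(** The claim is exact for the simple functions of an approximating sequence, and
    a bounded functional carries their convergence in mean over to the scalar
    integrals. *)
Lemma is_bochner_integral_functional (X : T -> E) (A : set T) (v : E) :
  bochner_integrable P X -> measurable A -> is_bochner_integral P A X v ->
  (\int[P]_(t in A) (l (X t))%:E = (l v)%:E)%E.
Proof.
move=> Xb mA [s [ms sX sv]]; have [mX _] := Xb.
have Xa := strongly_measurable_approximable mX.
have Xi : P.-integrable A (fun t => (l (X t))%:E).
  exact: integrableS (bochner_integrable_functional Xb).
have lsv : (l (simple_integral P A (s k)))%:E @[k --> \oo] --> (l v)%:E.
  apply: cvg_EFin; first exact: nearW.
  apply/subr_cvg0; apply/norm_cvg0P.
  have h : C * `|simple_integral P A (s k) - v| @[k --> \oo] --> (0 : R).
    rewrite -[X in _ --> X](mulr0 C); apply: cvgM; first exact: cvg_cst.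
    by apply/norm_cvg0P; apply/subr_cvg0.
  apply: (squeeze_cvgr _ _ h); last exact: cvg_cst.
  by apply: nearW => k /=; rewrite normr_ge0 -lB l_bounded.
have lsX : (l (simple_integral P A (s k)))%:E @[k --> \oo] -->
    (\int[P]_(t in A) (l (X t))%:E)%E.
  have Ifin := integrable_fin_num mA Xi.
  rewrite -[X in _ --> X]fineK//; apply: cvg_EFin; first exact: nearW.
  apply/subr_cvg0; apply/norm_cvg0P.
  have /fine_cvgP[Dfin D0] := sX.
  have h : `|C| * fine (\int[P]_(t in A) `|X t - simple_eval (s k) t|%:E)%E
      @[k --> \oo] --> (0 : R).
    by rewrite -[X in _ --> X](mulr0 `|C|); apply: cvgM; first exact: cvg_cst.
  apply: (squeeze_cvgr _ _ h); last exact: cvg_cst.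
  near=> k; rewrite normr_ge0/=.
  have Dk : (\int[P]_(t in A) `|X t - simple_eval (s k) t|%:E)%E \is a fin_num.
    by near: k.
  have [Si SE] := integrable_simple mA (ms k).
  have Sa := approximable_simple (ms k).
  have mXS : measurable_fun A (fun t => (`|X t - simple_eval (s k) t|)%:E).
    apply/measurable_EFinP; apply: measurable_funTS.
    by apply: approximable_norm; exact: approximableB.
  rewrite -lee_fin EFinM fineK// -ge0_integralZl_EFin//.
  rewrite -[leLHS]/(`|(_ - _)%:E|%E) EFinB fineK// -SE -integralB//.
  have miB : measurable_fun A (fun t => (l (simple_eval (s k) t))%:E - (l (X t))%:E)%E.
    by have /integrableP[] := integrableB mA Si Xi.
  apply: le_trans (le_abse_integral _ mA miB) _.
  apply: ge0_le_integral => //.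
  - exact: measurableT_comp.
  - by apply: emeasurable_funM => //; exact: measurable_cst.
  - move=> t _; rewrite -EFinB/= lee_fin -lB distrC.
    exact: le_trans (l_bounded _) (ler_wpM2r _ (ler_norm C)).
by rewrite (cvg_unique (@ereal_hausdorff R) lsX lsv).
Unshelve. all: by end_near. Qed.

End bochner_integral.

(** The factor [a], which is known when [G] is, may be pulled out of the
    expectation.  It is replaced by a countably valued approximation, whose level
    sets belong to [G] and on which it is one of the constants [x] of the
    hypothesis. *)
Lemma integral_dot_eq0 (R : realType) (K : normedModType R) (dot : {dot K for idfun})
    (dot_norm : induces_norm dot) d (T : measurableType d) (P : probability T R)
    (G : set (set T)) (a xi : T -> K) (A : set T) :
  <<s G >> `<=` measurable -> approximable (T := g_sigma_algebraType G) a ->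
  approximable xi -> <<s G >> A -> P.-integrable A (fun t => (`|xi t|)%:E) ->
  P.-integrable A (fun t => (dot (a t) (xi t))%:E) ->
  (forall B x, <<s G >> B -> (\int[P]_(t in B) (dot x (xi t))%:E = 0)%E) ->
  (\int[P]_(t in A) (dot (a t) (xi t))%:E = 0)%E.
Proof.
move=> Gsub aa xia GA xii axii orth; have mA := Gsub _ GA.
suff H e : 0 < e -> (`|\int[P]_(t in A) (dot (a t) (xi t))%:E| <=
    e%:E * \int[P]_(t in A) (`|xi t|)%:E)%E.
  have Ifin := integrable_fin_num mA axii.
  have Jfin := integrable_fin_num mA xii.
  rewrite -(fineK Ifin); congr EFin; apply/eqP; rewrite -normr_eq0 eq_le normr_ge0 andbT.
  have J0 : 0 <= fine (\int[P]_(t in A) (`|xi t|)%:E)%E.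
    by rewrite fine_ge0// integral_ge0// => t _; rewrite lee_fin.
  set J := fine _ in J0; apply/ler_addgt0Pr => e e0; rewrite add0r.
  have J10 : 0 < J + 1 by rewrite ltr_wpDl.
  have := H (e / (J + 1)) (divr_gt0 e0 J10).
  rewrite -{1}(fineK Ifin) -(fineK Jfin) -EFinM lee_fin -/J.
  move=> /le_trans; apply; rewrite -mulrA ler_piMr ?(ltW e0)//.
  by rewrite mulrC ler_pdivrMr// mul1r lerDl.
move=> e0; have [N [x [mN xP]]] := aa e e0.
have mNT : measurable_fun [set: T] N by move=> _ B mB; apply: Gsub; exact: mN.
pose b t := x (N t).
have ba : approximable (b : T -> K).
  move=> r r0; exists N, x; split => // t; by rewrite subrr normr0.
have aaT : approximable (a : T -> K).
  move=> r r0; have [N' [x' [mN' xP']]] := aa r r0; exists N', x'; split => //.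
  by move=> _ B mB; apply: Gsub; exact: mN'.
have diff t : `|dot (a t) (xi t) - dot (b t) (xi t)| <= e * `|xi t|.
  rewrite -dotNl -dotDl (le_trans (abs_dot_le_norm dot_norm _ _))//.
  by rewrite ler_wpM2r// ltW// xP.
have mdot (u : T -> K) : approximable u ->
    measurable_fun A (fun t => (dot (u t) (xi t))%:E).
  move=> ua; apply/measurable_EFinP; apply: measurable_funTS.
  exact: approximable_dot.
have exi : P.-integrable A (fun t => e%:E * (`|xi t|)%:E)%E by exact: integrableZl.
have diffi : P.-integrable A
    (fun t => (dot (a t) (xi t))%:E - (dot (b t) (xi t))%:E)%E.
  apply: le_integrable exi => //.
    by apply: emeasurable_funB; exact: mdot.
  by move=> t _; rewrite -EFinB -EFinM /= lee_fin (le_trans (diff t))// ler_norm.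
have bxii : P.-integrable A (fun t => (dot (b t) (xi t))%:E).
  have := integrableB mA axii diffi; apply: eq_integrable => // t _ /=.
  by rewrite -!EFinB; congr EFin; ring.
have b_int : (\int[P]_(t in A) (dot (b t) (xi t))%:E = 0)%E.
  have GN j : <<s G >> (N @^-1` [set j]).
    by have := mN measurableT [set j] I; rewrite setTI.
  have GAN j : <<s G >> (A `&` N @^-1` [set j]).
    exact: (@measurableI _ (g_sigma_algebraType G) _ _ GA (GN j)).
  have AE : A = \bigcup_j (A `&` N @^-1` [set j]).
    by apply/seteqP; split => [t At|t [j _ []]//]; exists (N t).
  rewrite AE integral_bigcup.
  - apply: eseries0 => j _ _; rewrite -(orth _ (x j) (GAN j)).
    by apply: eq_integral => t; rewrite inE => -[_ /= Nt]; rewrite /b Nt.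
  - by apply/trivIsetP => i j _ _ /eqP ij; apply/seteqP; split => // t [[_ /= ->] [_ /= /ij]].
  - by move=> j; exact: Gsub.
  - by rewrite -AE.
rewrite -[X in `|X|%E]sube0 -b_int -integralB//.
have ege0 := ltW e0; have /integrableP[mxi _] := xii.
rewrite -ge0_integralZl_EFin//.
have /integrableP[mdiff _] := diffi; have /integrableP[mexi _] := exi.
apply: le_trans (le_abse_integral _ mA mdiff) _.
apply: ge0_le_integral => //.
- exact: measurableT_comp.
- by move=> t _; rewrite -EFinB -EFinM /= lee_fin.
Qed.

(** * Separable subspaces and weak limits *)

(** A Pettis-type criterion.  For [y] in the closure of the [v i] one has
    [|y|^2 = sup_i (2 <y, v i> - |v i|^2)], because
    [|y|^2 - (2 <y, v> - |v|^2) = |y - v|^2]. *)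
Lemma approximable_weakly_measurable (R : realType) (K : normedModType R)
    (dot : {dot K for idfun}) (dot_norm : induces_norm dot) d
    (T : measurableType d) (X : T -> K) (x : nat -> K) :
  (forall t (e : R), 0 < e -> exists j, `|X t - x j| < e) ->
  (forall j, measurable_fun setT (fun t => dot (X t) (x j))) ->
  approximable X.
Proof.
move=> Xx mX; apply: (approximable_of_dense (x := x)) => // j e e0.
have mf : measurable_fun setT (fun t => `|X t - x j| ^+ 2).
  apply: (measurability _ (RGenOInfty.measurableE R)) => _ [_ [c ->] <-].
  rewrite setTI.
  pose g i t := 2 * dot (X t - x j) (x i - x j) - `|x i - x j| ^+ 2.
  have gE i t : g i t = `|X t - x j| ^+ 2 - `|X t - x i| ^+ 2.
    rewrite /g; have -> : X t - x i = (X t - x j) - (x i - x j).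
      by rewrite opprB addrA subrK.
    move: (X t - x j) (x i - x j) => y v.
    rewrite !dot_norm !dotE (dotC dot v y); ring.
  have mg i : measurable_fun setT (g i).
    have -> : g i = (fun t => 2 * (dot (X t) (x i) - dot (X t) (x j)
        - dot (x j) (x i - x j)) - `|x i - x j| ^+ 2).
      by apply/funext => t; rewrite /g !dotE; ring.
    apply: measurable_funB; last exact: measurable_cst.
    apply: measurable_funM; first exact: measurable_cst.
    apply: measurable_funB; last exact: measurable_cst.
    exact: measurable_funB.
  have -> : (fun t => `|X t - x j| ^+ 2) @^-1` [set` `]c, +oo[] =
      \bigcup_i ((g i) @^-1` [set` `]c, +oo[]).
    apply/seteqP; split => t /=.
      rewrite in_itv/= andbT => cX.
      have r0 : 0 < Num.sqrt (`|X t - x j| ^+ 2 - c) by rewrite sqrtr_gt0 subr_gt0.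
      have [i ir] := Xx t _ r0; exists i => //=; rewrite in_itv/= andbT gE.
      rewrite ltrBrDl -ltrBrDr.
      rewrite -[ltRHS]sqr_sqrtr ?subr_ge0 ?(ltW cX)//.
      by rewrite ltrXn2r ?nnegrE ?sqrtr_ge0.
    move=> [i _] /=; rewrite !in_itv/= !andbT gE => /lt_le_trans; apply.
    by rewrite gerBl exprn_ge0.
  apply: bigcupT_measurable => i; rewrite -[X in measurable X]setTI.
  by apply: mg => //; exact: measurable_itv.
have -> : [set t | `|X t - x j| < e] =
    (fun t => `|X t - x j| ^+ 2) @^-1` [set` `]-oo, (e ^+ 2)[].
  have ege0 := ltW e0.
  by apply/seteqP; split => t /=; rewrite in_itv/= ltr_sqr ?nnegrE.
by rewrite -[X in measurable X]setTI; apply: mf => //; exact: measurable_itv.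
Qed.

(** The rational combinations of a countable set form a countable set, whose
    closure is stable under real combinations. *)
Lemma separable_span (R : realType) (K : normedModType R) (D : nat -> set K) :
  (forall n, countable (D n)) ->
  exists x : nat -> K, [/\ closure (range x) 0,
    forall s u v, closure (range x) u -> closure (range x) v ->
      closure (range x) (u + s *: v) &
    forall n, closure (D n) `<=` closure (range x)].
Proof.
move=> Dc.
have clP (y : nat -> K) u : closure (range y) u <->
    forall e : R, 0 < e -> exists j, `|u - y j| < e.
  split=> [cu e e0|H B /nbhs_ballP[e /= e0 eB]].
    have [|_ [[j _ <-]]] := cu (ball u e); first exact: nbhsx_ballx.
    by rewrite -ball_normE/=; exists j.
  have [j uj] := H e e0; exists (y j); split; first by exists j.
  by apply: eB; rewrite -ball_normE.
have [b [_ bP]] := separable_subset 0 (bigcup_countable (countableP setT) (fun i _ => Dc i))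
  (@subset_closure _ (\bigcup_i D i)).
pose comb (s : seq (rat * nat)) : K := \sum_(p <- s) ratr p.1 *: b p.2.
pose x n := comb (odflt [::] (unpickle n)).
have xE s : x (pickle s) = comb s by rewrite /x pickleK.
have combP n : exists s, x n = comb s by rewrite /x; eexists.
exists x; split.
- apply/clP => e e0; exists (pickle ([::] : seq (rat * nat))).
  by rewrite xE /comb big_nil subrr normr0.
- move=> s u v /clP cu /clP cv; apply/clP => e e0.
  have e30 : 0 < e / 3 by rewrite divr_gt0.
  have [i ui] := cu _ e30; have [c1 c1E] := combP i.
  have v10 : 0 < `|v| + 1 by rewrite ltr_wpDl.
  have [q] : exists q : rat, ratr q \in `](s - e / 3 / (`|v| + 1)), s[.
    by apply: rat_in_itvoo; rewrite ltrBlDr ltrDl divr_gt0.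
  rewrite in_itv/= => /andP[q1 q2].
  have q10 : 0 < `|ratr q : R| + 1 by rewrite ltr_wpDl.
  have [j vj] := cv (e / 3 / (`|ratr q : R| + 1)) (divr_gt0 e30 q10).
  have [c2 c2E] := combP j.
  exists (pickle (c1 ++ [seq (q * p.1, p.2) | p <- c2])).
  have combZ : comb [seq (q * p.1, p.2) | p <- c2] = ratr q *: comb c2.
    rewrite /comb big_map scaler_sumr; apply: eq_bigr => p _ /=.
    by rewrite rmorphM scalerA.
  have -> : x (pickle (c1 ++ [seq (q * p.1, p.2) | p <- c2])) = x i + ratr q *: x j.
    by rewrite xE c1E c2E -combZ /comb big_cat.
  have -> : u + s *: v - (x i + ratr q *: x j) =
      (u - x i) + ((s - ratr q) *: v + ratr q *: (v - x j)).
    rewrite scalerBl scalerBr opprD addrACA; congr (_ + _).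
    by rewrite addrA subrK.
  apply: le_lt_trans (ler_normD _ _) _.
  have -> : e = e / 3 + (e / 3 + e / 3) by field.
  apply: ltrD => //; apply: le_lt_trans (ler_normD _ _) _.
  rewrite (normrZ (s - ratr q)) (normrZ (ratr q)); apply: ltr_leD.
    apply: (@le_lt_trans _ _ (`|s - ratr q| * (`|v| + 1))).
      by rewrite ler_wpM2l// lerDl.
    by rewrite -ltr_pdivlMr// ger0_norm ?subr_ge0 ?(ltW q2)// ltrBlDr -ltrBlDl.
  apply: (@le_trans _ _ ((`|ratr q : R| + 1) * `|v - x j|)).
    by rewrite ler_wpM2r// lerDl.
  by rewrite mulrC -ler_pdivlMr// ltW.
- move=> n u cu; apply/clP => e e0.
  have e20 : 0 < e / 2 by rewrite divr_gt0.
  have [|y [Dy uy]] := cu (ball u (e / 2)); first exact: nbhsx_ballx.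
  have [|j yj] := bP y (e / 2) _ e20; first by exists n.
  exists (pickle [:: (1%Q, j)]); rewrite xE /comb big_seq1/= rmorph1 scale1r.
  rewrite -(subrKA y) (le_lt_trans (ler_normD _ _))// (splitr e) ltrD//.
  by move: uy; rewrite -ball_normE.
Qed.

(** * Almost sure finiteness from integral bounds *)

Section almost_everywhere_finite.
Context d (T : measurableType d) (R : realType) (P : probability T R).
Local Open Scope ereal_scope.

Lemma ae_lty_of_integral (f : T -> \bar R) :
  (forall t, 0 <= f t) -> measurable_fun setT f -> \int[P]_t f t < +oo ->
  \forall t \ae P, f t < +oo.
Proof.
move=> f0 mf fi.
have : P.-integrable setT f.
  apply/integrableP; split => //.
  by under eq_integral do rewrite gee0_abs//.
move=> /(integrable_ae measurableT); apply: filterS => t /(_ I).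
by rewrite ge0_fin_numE.
Qed.

(** By monotone convergence the supremum of the [f n] has a finite integral. *)
Lemma ae_bounded_of_integral (f : nat -> T -> R) (C : \bar R) :
  (forall n t, (0 <= f n t)%R) -> (forall n, measurable_fun setT (f n)) ->
  (forall t, nondecreasing_seq (f^~ t)) ->
  C < +oo -> (forall n, \int[P]_t (f n t)%:E <= C) ->
  \forall t \ae P, exists M, forall n, (f n t <= M)%R.
Proof.
move=> f0 mf nf Coo fC.
pose g t := limn (fun n => (f n t)%:E).
have ndf t : nondecreasing_seq (fun n => (f n t)%:E).
  by move=> m n mn; rewrite lee_fin nf.
have g_ge n t : (f n t)%:E <= g t.
  apply: lime_ge; first exact: ereal_nondecreasing_is_cvgn.
  by exists n => // m /= nm; exact: ndf.
have mF n : measurable_fun setT (fun t => (f n t)%:E) by exact/measurable_EFinP.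
have g0 t : 0 <= g t by apply: le_trans (g_ge 0%N t); rewrite lee_fin.
have : \forall t \ae P, g t < +oo.
  apply: ae_lty_of_integral => //.
    apply: (emeasurable_fun_cvg (fun n t => (f n t)%:E)) => // t _.
    exact: ereal_nondecreasing_is_cvgn.
  apply: le_lt_trans Coo.
  rewrite (monotone_convergence P measurableT mF) //; last first.
  - by move=> n t _; rewrite lee_fin.
  - apply: lime_le; last exact: nearW.
    apply: ereal_nondecreasing_is_cvgn => m n mn.
    by apply: ge0_le_integral => // t _; rewrite lee_fin ?f0// nf.
apply: filterS => t gt; exists (fine (g t)) => n.
by rewrite -lee_fin fineK ?ge0_fin_numE.
Qed.

Lemma ae_cvg_series_of_integral (f : nat -> T -> R) (C : \bar R) :
  (forall n t, (0 <= f n t)%R) -> (forall n, measurable_fun setT (f n)) ->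
  C < +oo -> (forall n, \int[P]_t (series (f^~ t) n)%:E <= C) ->
  \forall t \ae P, cvgn (series (f^~ t)).
Proof.
move=> f0 mf Coo fC.
have nds t : nondecreasing_seq (series (f^~ t)).
  by apply/nondecreasing_seqP => n; rewrite seriesSr lerDl.
have := @ae_bounded_of_integral (fun n t => series (f^~ t) n) C.
move=> /(_ _ _ nds Coo fC) H; apply: filterS (H _ _) => [t [M fM]|n t|n].
- by apply: nondecreasing_is_cvgn => //; exists M => _ [n _ <-].
- by apply: sumr_ge0.
- exact: measurable_sum.
Qed.

Lemma integral_if (D : set T) (h : T -> bool) (f : T -> R) :
  \int[P]_(t in D) (if h t then f t else 0%R)%:E =
  \int[P]_(t in D `&` [set t | h t]) (f t)%:E.
Proof.
rewrite integral_mkcondr; apply: eq_integral => t _; rewrite patchE.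
by case: ifP => ht; [rewrite mem_set|rewrite memNset//= ht].
Qed.

End almost_everywhere_finite.

Section sub_sigma_algebra.
Context d (T : measurableType d) (R : realType).

Lemma sub_measurable_fun (G H : set (set T)) d' (S : measurableType d')
    (f : T -> S) : <<s G >> `<=` <<s H >> ->
  measurable_fun [set: g_sigma_algebraType G] (f : g_sigma_algebraType G -> S) ->
  measurable_fun [set: g_sigma_algebraType H] (f : g_sigma_algebraType H -> S).
Proof. by move=> GH mf _ A mA; apply: GH; exact: mf. Qed.

Lemma sub_measurable_funT (G : set (set T)) d' (S : measurableType d')
    (f : T -> S) : <<s G >> `<=` measurable ->
  measurable_fun [set: g_sigma_algebraType G] (f : g_sigma_algebraType G -> S) ->
  measurable_fun [set: T] f.
Proof. by move=> GH mf _ A mA; apply: GH; exact: mf. Qed.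

End sub_sigma_algebra.

(** * Upcrossings and nonnegative supermartingales *)

Section upcrossings.
Variables (R : realType) (a b : R) (y : nat -> R).

(** The strategy that enters below [a] and leaves above [b]. *)
Fixpoint holding n : bool :=
  if n is m.+1 then (if holding m then y m.+1 <= b else y m.+1 < a)
  else y 0%N < a.

Fixpoint upcrossings n : nat :=
  if n is m.+1 then (upcrossings m + (holding m && (b < y m.+1)%R))%N else 0%N.

Lemma upcrossings_nondecreasing : nondecreasing_seq upcrossings.
Proof. by apply/nondecreasing_seqP => n /=; exact: leq_addr. Qed.

Lemma holding_enter m : a <= b -> y m < a -> holding m.
Proof.
case: m => //= m ab ym; case: ifP => // _.
by rewrite (le_trans (ltW ym)).
Qed.

Lemma holding_leave m k : holding m -> b < y (m + k.+1) ->
  exists n, (upcrossings m < upcrossings n)%N.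
Proof.
elim: k m => [|k IH] m hm.
  by rewrite addn1 => bm; exists m.+1; rewrite /= hm bm addn1.
have [bm _|bm] := ltP b (y m.+1); first by exists m.+1; rewrite /= hm bm addn1.
rewrite addnS -addSn => /IH[|n]; first by rewrite /= hm.
by move=> /(leq_ltn_trans (upcrossings_nondecreasing (leqnSn m))); exists n.
Qed.

Lemma upcrossings_unbounded : a <= b ->
  (forall N, exists2 n, (N <= n)%N & y n < a) ->
  (forall N, exists2 n, (N <= n)%N & b < y n) ->
  forall k, exists n, (k <= upcrossings n)%N.
Proof.
move=> ab ya yb; elim=> [|k [n kn]]; first by exists 0%N.
have [p np /(holding_enter ab) hp] := ya n.
have [q pq yq] := yb p.+1.
have qE : q = (p + (q - p.+1).+1)%N by rewrite addnS -addSn subnKC.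
move: yq; rewrite qE => /(holding_leave hp)[r pr]; exists r.
exact: leq_ltn_trans (leq_trans kn (upcrossings_nondecreasing np)) pr.
Qed.

(** A nonnegative lower bound for [a] plus the gains of that strategy, each
    completed upcrossing having brought at least [b - a].  Working with it instead
    of the gains themselves, one only integrates nonnegative functions. *)
Definition wealth n := (b - a) * (upcrossings n)%:R + (if holding n then y n else a).

Lemma wealth_step n : a <= b ->
  wealth n.+1 <=
  (b - a) * (upcrossings n)%:R + (if holding n then y n.+1 else a).
Proof.
move=> ab; rewrite /wealth /=; case: (holding n) => /=.
  have [yb|yb] := ltP b (y n.+1); last by rewrite addn0.
  by rewrite addn1 -natr1 mulrDr mulr1 -addrA lerD2l; lra.
by rewrite addn0 lerD2l; case: ifP => // /ltW.
Qed.

End upcrossings.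

(** The limit is the infimum of the levels below which [y] passes infinitely
    often. *)
Lemma no_upcrossing_cvg (R : realType) (y : nat -> R) (M : R) :
  (forall n, 0 <= y n) -> (forall N, exists2 n, (N <= n)%N & y n < M) ->
  (forall p q : rat, ratr p < ratr q :> R ->
    (forall N, exists2 n, (N <= n)%N & y n < ratr p) ->
    (forall N, exists2 n, (N <= n)%N & ratr q < y n) -> False) ->
  cvgn y.
Proof.
move=> y0 yM nocross.
pose S := [set x | forall N, exists2 n, (N <= n)%N & y n < x].
have SM : S M by [].
have Sinf : has_inf S.
  split; first by exists M.
  by exists 0 => x /(_ 0%N)[n _] /ltW; apply: le_trans.
apply/cvg_ex; exists (inf S); apply/cvgrPdist_lt => e e0.
have low : \forall n \near \oo, inf S - e / 2 <= y n.
  have /existsNP[N yN] : ~ S (inf S - e / 2).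
    by move=> /(ge_inf Sinf.2); lra.
  exists N => // n /= Nn; rewrite leNgt; apply/negP => yn.
  by apply: yN; exists n.
have high : \forall n \near \oo, y n <= inf S + e / 2.
  have e3 : 0 < e / 6 by lra.
  have [x Sx xS] := inf_adherent e3 Sinf.
  have [p] : exists p : rat, ratr p \in `](inf S + e / 6), (inf S + e / 3)[.
    by apply: rat_in_itvoo; lra.
  rewrite in_itv/= => /andP[p1 p2].
  have [q] : exists q : rat, ratr q \in `](inf S + e / 3), (inf S + e / 2)[.
    by apply: rat_in_itvoo; lra.
  rewrite in_itv/= => /andP[q1 q2].
  have Sp N : exists2 n, (N <= n)%N & y n < ratr p.
    have [n Nn yn] := Sx N; exists n => //.
    by rewrite (lt_trans yn)// (lt_trans xS).
  have /existsNP[N yN] := @nocross p q (lt_trans p2 q1) Sp.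
  exists N => // n /= Nn; rewrite leNgt; apply/negP => yn.
  by apply: yN; exists n => //; rewrite (lt_trans q2).
near=> n.
have nl : inf S - e / 2 <= y n by near: n.
have nh : y n <= inf S + e / 2 by near: n.
by rewrite ltr_norml; apply/andP; split; lra.
Unshelve. all: by end_near. Qed.

Section supermartingale.
Context d (T : measurableType d) (R : realType) (P : probability T R).
Variable F : nat -> set (set T).
Hypothesis F_sub : forall n, <<s F n>> `<=` measurable.
Hypothesis F_mono : forall n, <<s F n>> `<=` <<s F n.+1>>.

Local Notation "'adapted' n f" :=
  (measurable_fun [set: g_sigma_algebraType (F n)]
     (f : g_sigma_algebraType (F n) -> _)) (at level 10, n at level 9, f at level 9).

Let F_le m n : (m <= n)%N -> <<s F m>> `<=` <<s F n>>.
Proof.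
elim: n => [|n IH]; first by rewrite leqn0 => /eqP ->.
rewrite leq_eqVlt => /predU1P[-> //|]; rewrite ltnS => /IH mn A FA.
by apply: F_mono; exact: mn.
Qed.

Section upcrossing_inequality.
Variables (Y : nat -> T -> R).
Hypothesis Y0 : forall n t, 0 <= Y n t.
Hypothesis Y_adapted : forall n, adapted n (Y n).
Hypothesis Y_super : forall n A, <<s F n>> A ->
  (\int[P]_(t in A) (Y n.+1 t)%:E <= \int[P]_(t in A) (Y n t)%:E)%E.
Variables (a b : R).
Hypotheses (a0 : 0 <= a) (ab : a < b).

Let Y_next n : adapted n.+1 (Y n).
Proof. exact: (sub_measurable_fun (@F_mono n) (@Y_adapted n)). Qed.

Lemma holding_adapted n : adapted n (fun t => holding a b (Y^~ t) n).
Proof.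
elim: n => [|n IH] /=; first exact: measurable_fun_ltr.
apply: measurable_fun_ifT.
- exact: (sub_measurable_fun (@F_mono n) IH).
- exact: measurable_fun_ler.
- exact: measurable_fun_ltr.
Qed.

Lemma upcrossings_adapted n :
  adapted n (fun t => (upcrossings a b (Y^~ t) n)%:R : R).
Proof.
elim: n => [|n IH] /=; first exact: measurable_cst.
under eq_fun do rewrite natrD.
apply: measurable_funD; first exact: (sub_measurable_fun (@F_mono n) IH).
rewrite (_ : (fun x => _) = (fun t => if holding a b (Y^~ t) n && (b < Y n.+1 t)
  then 1 else 0 : R)); last by apply/funext => t; case: (_ && _).
apply: measurable_fun_ifT => //; apply: measurable_and.
  exact: (sub_measurable_fun (@F_mono n) (@holding_adapted n)).
exact: measurable_fun_ltr.
Qed.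

Let wealth_ge0 n t : 0 <= wealth a b (Y^~ t) n.
Proof.
rewrite /wealth addr_ge0// ?mulr_ge0// ?subr_ge0 ?(ltW ab)//.
by case: ifP.
Qed.

(** Whether the strategy holds at time [n] is decided by the past, so that a
    supermartingale brings it no gain on average; initially [wealth] is at most
    [a]. *)
Lemma integral_wealth_le n : (\int[P]_t (wealth a b (Y^~ t) n)%:E <= a%:E)%E.
Proof.
have mY k : measurable_fun setT (Y k) by exact: sub_measurable_funT (@F_sub _) (@Y_adapted k).
have mh k : measurable_fun setT (fun t => holding a b (Y^~ t) k).
  by exact: sub_measurable_funT (@F_sub _) (@holding_adapted k).
have mu k : measurable_fun setT (fun t => (upcrossings a b (Y^~ t) k)%:R : R).
  by exact: sub_measurable_funT (@F_sub _) (@upcrossings_adapted k).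
have mw k : measurable_fun setT (fun t => wealth a b (Y^~ t) k).
  apply: measurable_funD; first exact: measurable_funM.
  exact: measurable_fun_ifT.
elim: n => [|n IH].
  apply: (@le_trans _ _ (\int[P]_t (cst a%:E) t)%E); last first.
    by rewrite integral_cst// [X in (_ * X)%E]probability_setT mule1.
  apply: ge0_le_integral => //; try exact/measurable_EFinP.
    by move=> t _; rewrite lee_fin.
  move=> t _; rewrite lee_fin /wealth /= mulr0 add0r.
  by case: ifP => // /ltW.
apply: le_trans IH.
pose g t := (b - a) * (upcrossings a b (Y^~ t) n)%:R +
            (if holding a b (Y^~ t) n then 0 else a).
have g0 t : 0 <= g t.
  by rewrite /g addr_ge0 ?mulr_ge0 ?subr_ge0 ?(ltW ab)//; case: ifP.
have mg : measurable_fun setT g.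
  by apply: measurable_funD; [exact: measurable_funM|exact: measurable_fun_ifT].
have split k : (\int[P]_t ((b - a) * (upcrossings a b (Y^~ t) n)%:R +
    (if holding a b (Y^~ t) n then Y k t else a))%:E =
  \int[P]_t (g t)%:E +
   \int[P]_(t in [set t | holding a b (Y^~ t) n]) (Y k t)%:E)%E.
  rewrite -[X in (_ + \int[P]_(t in X) _)%E]setTI -integral_if -ge0_integralD//.
  - apply: eq_integral => t _; rewrite -EFinD; congr EFin.
    by rewrite /g; case: ifP; rewrite ?addr0.
  - by move=> t _; rewrite lee_fin.
  - exact/measurable_EFinP.
  - by move=> t _; rewrite lee_fin; case: ifP.
  - by apply/measurable_EFinP; exact: measurable_fun_ifT.
apply: (@le_trans _ _ (\int[P]_t ((b - a) * (upcrossings a b (Y^~ t) n)%:R +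
    (if holding a b (Y^~ t) n then Y n.+1 t else a))%:E)%E).
  apply: ge0_le_integral => //.
  - by move=> t _; rewrite lee_fin.
  - exact/measurable_EFinP.
  - apply/measurable_EFinP/measurable_funD; first exact: measurable_funM.
    exact: measurable_fun_ifT.
  - by move=> t _; rewrite lee_fin; apply: wealth_step; exact: ltW.
rewrite split [leRHS](split n); apply: leeD => //; apply: Y_super.
by have := @holding_adapted n measurableT [set true] I; rewrite setTI.
Qed.

Lemma ae_upcrossings_bounded :
  \forall t \ae P, exists M, forall n, (upcrossings a b (Y^~ t) n <= M)%N.
Proof.
have ba : 0 < b - a by rewrite subr_gt0.
have := @ae_bounded_of_integral _ _ _ P
  (fun n t => (b - a) * (upcrossings a b (Y^~ t) n)%:R) a%:E.
move=> /(_ _ _ _ (ltry _)) H; apply: filterS (H _ _ _ _) => {H}.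
- move=> t [M fM]; exists (Num.truncn (M / (b - a))).+1 => n.
  have : (upcrossings a b (Y^~ t) n)%:R <= M / (b - a).
    by rewrite ler_pdivlMr// mulrC.
  move=> /le_lt_trans /(_ (truncnS_gt _)); rewrite ltr_nat; exact: ltnW.
- by move=> n t; rewrite mulr_ge0 ?(ltW ba).
- move=> n; apply: measurable_funM => //.
  exact: sub_measurable_funT (@F_sub _) (@upcrossings_adapted n).
- move=> t m n mn; rewrite ler_pM2l// ler_nat.
  exact: upcrossings_nondecreasing.
- move=> n; apply: le_trans (integral_wealth_le n).
  have mu : measurable_fun setT (fun t => (upcrossings a b (Y^~ t) n)%:R : R).
    by exact: sub_measurable_funT (@F_sub _) (@upcrossings_adapted n).
  have mh : measurable_fun setT (fun t => holding a b (Y^~ t) n).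
    by exact: sub_measurable_funT (@F_sub _) (@holding_adapted n).
  have mY : measurable_fun setT (Y n) by exact: sub_measurable_funT (@F_sub _) (@Y_adapted n).
  apply: ge0_le_integral => //.
  + by move=> t _; rewrite lee_fin mulr_ge0 ?(ltW ba).
  + by apply/measurable_EFinP; exact: measurable_funM.
  + apply/measurable_EFinP/measurable_funD; first exact: measurable_funM.
    exact: measurable_fun_ifT.
  + by move=> t _; rewrite lee_fin /wealth lerDl; case: ifP.
Qed.

End upcrossing_inequality.

(** The upcrossing bounds for rational levels exclude oscillation, and Fatou's
    lemma excludes an infinite limit. *)
Lemma nonneg_supermartingale_cvg (Y : nat -> T -> R) :
  (forall n t, 0 <= Y n t) -> (forall n, adapted n (Y n)) ->
  (forall n A, <<s F n>> A ->
    (\int[P]_(t in A) (Y n.+1 t)%:E <= \int[P]_(t in A) (Y n t)%:E)%E) ->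
  (\int[P]_t (Y 0%N t)%:E < +oo)%E ->
  \forall t \ae P, cvgn (Y^~ t).
Proof.
move=> Y0 Yad Ysup Yi.
have mY k : measurable_fun setT (Y k) by exact: sub_measurable_funT (@F_sub _) (@Yad k).
have cross : \forall t \ae P, forall n,
    let pq := odflt (0, 0) (unpickle n : option (rat * rat)) in
    0 <= ratr pq.1 :> R -> ratr pq.1 < ratr pq.2 :> R ->
    exists M, forall n, (upcrossings (ratr pq.1) (ratr pq.2) (Y^~ t) n <= M)%N.
  apply: ae_foralln => n; case: (odflt _ _) => p q /=.
  have [p0|p0] := boolP (0 <= ratr p :> R); last exact: aeW.
  have [pq|pq] := boolP (ratr p < ratr q :> R); last exact: aeW.
  by apply: filterS (ae_upcrossings_bounded Y0 Yad Ysup p0 pq).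
have inf : \forall t \ae P, (limn_einf (fun n => (Y n t)%:E) < +oo)%E.
  apply: ae_lty_of_integral.
  - move=> t; rewrite limn_einf_lim; apply: lime_ge.
      exact: is_cvg_einfs.
    by apply: nearW => n; apply: le_ereal_inf_tmp => _ [m _ <-]; rewrite lee_fin.
  - rewrite (_ : (fun t => _) = (fun t => - limn_esup (fun n => - (Y n t)%:E))%E).
      apply: measurableT_comp => //; apply: measurable_fun_limn_esup => n.
      by apply: measurableT_comp => //; exact/measurable_EFinP.
    apply/funext => t; rewrite -limn_einfN; congr limn_einf.
    by apply/funext => n /=; rewrite opprK.
  apply: le_lt_trans (fatou P measurableT _ _) _.
  - by move=> n; exact/measurable_EFinP.
  - by move=> n t _; rewrite lee_fin.
  apply: le_lt_trans Yi.
  rewrite limn_einf_lim; apply: lime_le; first exact: is_cvg_einfs.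
  apply: nearW => n; apply: (@le_trans _ _ (\int[P]_t (Y n t)%:E)%E).
    by apply: ereal_inf_lbound; exists n => //=.
  elim: n => // n; apply: le_trans; apply: Ysup.
  exact: (@measurableT _ (g_sigma_algebraType (F n))).
apply: filterS2 cross inf => t cross inf.
have [M yM] : exists M, forall N, exists2 n, (N <= n)%N & Y n t < M.
  apply: contrapT => noM.
  suff Yoo : (Y n t)%:E @[n --> \oo] --> +oo%E.
    by rewrite (cvg_limn_einf_sup Yoo).1 in inf.
  apply/cvgeryP/cvgryPge => M.
  have /existsNP[N yN] := (forallNP _).2 noM M.
  exists N => // n /= Nn; rewrite leNgt; apply/negP => yn.
  by apply: yN; exists n.
apply: (no_upcrossing_cvg (M := M)) => // p q pq yp yq.
have p0 : 0 <= ratr p :> R.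
  by have [n _ /ltW] := yp 0%N; apply: le_trans.
have := cross (pickle (p, q)); rewrite pickleK /= => /(_ p0 pq) [B yB].
have [n] := upcrossings_unbounded (ltW pq) yp yq B.+1.
by rewrite ltnNge yB.
Qed.

(** * The Robbins-Siegmund theorem *)

Section robbins_siegmund.
Variables (X theta eta : nat -> T -> R).
Hypotheses (X0 : forall n t, 0 <= X n t) (X_adapted : forall n, adapted n (X n)).
Hypotheses (eta0 : forall n t, 0 <= eta n t)
  (eta_adapted : forall n, adapted n (eta n)).
Hypotheses (theta0 : forall n t, 0 <= theta n t)
  (theta_meas : forall n, measurable_fun [set: T] (theta n)).

Let mX n : measurable_fun setT (X n).
Proof. exact: sub_measurable_funT (@F_sub _) (@X_adapted n). Qed.

Let meta n : measurable_fun setT (eta n).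
Proof. exact: sub_measurable_funT (@F_sub _) (@eta_adapted n). Qed.

Section unweighted.
Hypothesis drift : forall n A, <<s F n>> A ->
  (\int[P]_(t in A) (X n.+1 t + theta n t)%:E <=
   \int[P]_(t in A) (X n t + eta n t)%:E)%E.

Let S t n : R := series (eta^~ t) n.

Let alive (m : R) n t : bool := (X 0%N t <= m) && (S t n <= m).

Let killed (m : R) n t : R := if alive m n t then X n t + (m - S t n) else 0.

Let S_pred n : adapted n (S^~ n.+1).
Proof.
elim: n => [|n IH].
  rewrite (_ : S^~ 1%N = eta 0%N); first exact: eta_adapted.
  by apply/funext => t; rewrite /S /series/= big_nat1.
rewrite (_ : S^~ n.+2 = (fun t => S t n.+1 + eta n.+1 t)); last first.
  by apply/funext => t; rewrite /S seriesSr.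
apply: measurable_funD; last exact: eta_adapted.
exact: (sub_measurable_fun (@F_mono n)) IH.
Qed.

Let mS n : measurable_fun setT (S^~ n).
Proof.
case: n => [|n]; last exact: sub_measurable_funT (@F_sub _) (@S_pred n).
rewrite (_ : S^~ 0%N = cst 0); first exact: measurable_cst.
by apply/funext => t; rewrite /S /series/= big_geq.
Qed.

Let S_adapted n : adapted n (S^~ n).
Proof.
case: n => [|n]; last exact: (sub_measurable_fun (@F_mono n)) (@S_pred n).
rewrite (_ : S^~ 0%N = cst 0); first exact: measurable_cst.
by apply/funext => t; rewrite /S /series/= big_geq.
Qed.

Let S_nd t : nondecreasing_seq (S t).
Proof. by apply/nondecreasing_seqP => n; rewrite /S seriesSr lerDl. Qed.

Let X0_adapted n : adapted n (X 0%N).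
Proof. exact: sub_measurable_fun (F_le (leq0n n)) (@X_adapted 0%N). Qed.

Let alive_pred m n : adapted n (alive m n.+1).
Proof.
by apply: measurable_and; apply: measurable_fun_ler => //; exact: measurable_cst.
Qed.

Let alive_adapted m n : adapted n (alive m n).
Proof.
by apply: measurable_and; apply: measurable_fun_ler => //; exact: measurable_cst.
Qed.

Let killed_adapted m n : adapted n (killed m n).
Proof.
apply: measurable_fun_ifT => //; apply: measurable_funD => //.
by apply: measurable_funB => //; exact: measurable_cst.
Qed.

Let killed_ge0 m n t : 0 <= killed m n t.
Proof.
by rewrite /killed; case: ifP => // /andP[_ Sm]; rewrite addr_ge0// subr_ge0.
Qed.

(** Adding the unspent budget [m - S t n] to [X n t] compensates for the [eta],
    and killing the process when the budget is exceeded keeps it nonnegative.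
    The inequality survives the killing because [S t n.+1], hence [alive m n.+1],
    is already known at time [n]. *)
Let killed_drift m n A : <<s F n>> A ->
  (\int[P]_(t in A) (killed m n.+1 t)%:E +
   \int[P]_(t in A) (if alive m n.+1 t then theta n t else 0)%:E <=
   \int[P]_(t in A) (killed m n t)%:E)%E.
Proof.
move=> FA; rewrite !integral_if; set B := A `&` _.
have FB : <<s F n>> B.
  have := @alive_pred m n measurableT [set true] I; rewrite setTI => FC.
  exact: (@measurableI _ (g_sigma_algebraType (F n)) _ _ FA FC).
have mA := F_sub FA; have mB := F_sub FB.
have SB t : B t -> 0 <= m - S t n.+1.
  by move=> [_ /andP[_]]; rewrite subr_ge0.
have mTB (f : T -> R) : measurable_fun setT f ->
    measurable_fun B (fun t => (f t)%:E).
  by move=> mf; apply/measurable_EFinP; exact: measurable_funTS.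
have mC k : measurable_fun setT (fun t => m - S t k).
  by apply: measurable_funB => //; exact: measurable_cst.
have mXC k : measurable_fun setT (fun t => X k t + (m - S t k)).
  exact: measurable_funD.
rewrite -ge0_integralD//; last 4 first.
- by move=> t Bt; rewrite lee_fin addr_ge0 ?SB.
- exact: mTB.
- by move=> t _; rewrite lee_fin.
- exact: mTB.
apply: (@le_trans _ _ (\int[P]_(t in B) (X n.+1 t + theta n t)%:E +
                       \int[P]_(t in B) (m - S t n.+1)%:E)%E).
  rewrite -ge0_integralD; [|by []|..]; last 4 first.
  - by move=> t _; rewrite lee_fin addr_ge0.
  - by apply: mTB; exact: measurable_funD.
  - by move=> t Bt; rewrite lee_fin SB.
  - exact: mTB.
  rewrite le_eqVlt; apply/orP; left; apply/eqP; apply: eq_integral => t _.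
  by rewrite -!EFinD addrAC.
apply: (@le_trans _ _ (\int[P]_(t in B) (X n t + (m - S t n))%:E)%E).
  apply: (le_trans (leeD (drift FB) (lexx _))).
  rewrite -ge0_integralD; [|by []|..]; last 4 first.
  - by move=> t _; rewrite lee_fin addr_ge0.
  - by apply: mTB; exact: measurable_funD.
  - by move=> t Bt; rewrite lee_fin SB.
  - exact: mTB.
  rewrite le_eqVlt; apply/orP; left; apply/eqP; apply: eq_integral => t _.
  by rewrite -!EFinD /S seriesSr; congr EFin; ring.
have mD : measurable (A `&` [set t | alive m n t]).
  apply: measurableI => //.
  have := @alive_adapted m n measurableT [set true] I; rewrite setTI.
  exact: F_sub.
apply: ge0_subset_integral => //.
- by apply/measurable_EFinP; exact: measurable_funTS.
- by move=> t [_ /andP[_ Sm]]; rewrite lee_fin addr_ge0// subr_ge0.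
- move=> t [At /andP[Xm Sm]]; split => //; rewrite /= /alive Xm/=.
  exact: le_trans (S_nd t (leqnSn n)) Sm.
Qed.

Let theta_alive m n t : R := if alive m n.+1 t then theta n t else 0.

Let theta_alive_ge0 m n t : 0 <= theta_alive m n t.
Proof. by rewrite /theta_alive; case: ifP. Qed.

Let mtheta_alive m n : measurable_fun setT (theta_alive m n).
Proof.
apply: measurable_fun_ifT => //.
exact: sub_measurable_funT (@F_sub _) (@alive_pred m n).
Qed.

Let mkilled m n : measurable_fun setT (killed m n).
Proof. exact: sub_measurable_funT (@F_sub _) (@killed_adapted m n). Qed.

Let killed0_le m : 0 <= m ->
  (\int[P]_t (killed m 0%N t)%:E <= (2 * m)%:E)%E.
Proof.
move=> m0; apply: (@le_trans _ _ (\int[P]_t (cst (2 * m)%:E) t)%E); last first.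
  by rewrite integral_cst// [X in (_ * X)%E]probability_setT mule1.
apply: ge0_le_integral => //; try exact/measurable_EFinP.
  by move=> t _; rewrite lee_fin.
move=> t _; rewrite lee_fin /killed; case: ifP => [/andP[Xm _]|_].
  by rewrite /S /series/= big_geq// subr0; lra.
by rewrite mulr_ge0.
Qed.

Let integral_theta_alive m n : 0 <= m ->
  (\int[P]_t (series (fun k => theta_alive m k t) n)%:E <= (2 * m)%:E)%E.
Proof.
move=> m0; apply: le_trans (killed0_le m0).
have ser0 k t : 0 <= series (fun k => theta_alive m k t) k.
  exact: sumr_ge0.
have mser k : measurable_fun setT (fun t => series (fun k => theta_alive m k t) k).
  exact: measurable_sum.
suff : (\int[P]_t (killed m n t)%:E +
   \int[P]_t (series (fun k => theta_alive m k t) n)%:E <=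
   \int[P]_t (killed m 0%N t)%:E)%E.
  apply: le_trans; apply: leeDr; apply: integral_ge0 => t _.
  by rewrite lee_fin.
elim: n => [|n IH].
  rewrite [X in (_ + X)%E]integral0_eq ?adde0// => t _.
  by rewrite /series/= big_geq.
apply: le_trans IH.
rewrite [X in (_ + X <= _)%E](_ : _ = \int[P]_t (theta_alive m n t)%:E +
    \int[P]_t (series (fun k => theta_alive m k t) n)%:E)%E; last first.
  rewrite -ge0_integralD//; try exact/measurable_EFinP; last 2 first.
  - by move=> t _; rewrite lee_fin.
  - by move=> t _; rewrite lee_fin.
  by apply: eq_integral => t _; rewrite seriesSr -EFinD addrC.
rewrite addeA; apply: leeD => //; apply: killed_drift.
exact: (@measurableT _ (g_sigma_algebraType (F n))).
Qed.

Lemma robbins_siegmund_unweighted :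
  (\forall t \ae P, cvgn (series (eta^~ t))) ->
  \forall t \ae P, cvgn (X^~ t) /\ cvgn (series (theta^~ t)).
Proof.
move=> eta_cvg.
have kill_cvg : \forall t \ae P, forall m : nat, cvgn ((killed m%:R)^~ t).
  apply: ae_foralln => m; apply: nonneg_supermartingale_cvg => //.
    move=> n A /(killed_drift m%:R); apply: le_trans; apply: leeDl.
    by apply: integral_ge0 => t _; rewrite lee_fin; exact: theta_alive_ge0.
  by apply: le_lt_trans (killed0_le (ler0n _ m)) _; exact: ltry.
have theta_cvg : \forall t \ae P, forall m : nat,
    cvgn (series ((theta_alive m%:R)^~ t)).
  apply: ae_foralln => m.
  apply: (@ae_cvg_series_of_integral _ _ _ _ _ (2 * m%:R)%:E) => //.
    exact: ltry.
  by move=> n; exact: integral_theta_alive.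
have [eC kC] := (eta_cvg, kill_cvg).
near=> t.
have ec : cvgn (series (eta^~ t)) by near: t.
have [M SM] : exists M : nat, forall n, alive M%:R n t.
  exists (Num.truncn (Num.max (X 0%N t) (limn (series (eta^~ t))))).+1 => n.
  rewrite /alive; apply/andP; split.
    by rewrite ltW// (le_lt_trans _ (truncnS_gt _))// le_max lexx.
  rewrite ltW// (le_lt_trans _ (truncnS_gt _))// le_max.
  by rewrite (nondecreasing_cvgn_le (S_nd t) ec) orbT.
have kc : cvgn ((killed M%:R)^~ t) by move: M {SM}; near: t.
have tc : cvgn (series ((theta_alive M%:R)^~ t)) by move: M {SM kc}; near: t.
split.
  rewrite (_ : X^~ t = (fun n => killed M%:R n t - (M%:R - S t n))); last first.
    by apply/funext => n; rewrite /killed SM addrK.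
  apply: is_cvgB => //; apply: is_cvgB => //; exact: is_cvg_cst.
rewrite (_ : theta^~ t = (theta_alive M%:R)^~ t)//.
by apply/funext => n; rewrite /theta_alive SM.
Unshelve. all: by end_near. Qed.

End unweighted.

End robbins_siegmund.

(** The Robbins-Siegmund theorem, with the conditional expectations tested on
    the events of the past.  Multiplying by [exp (- sum_{k<n} alpha_k)] removes
    the factors [1 + alpha_n]. *)
Theorem robbins_siegmund (alpha : nat -> R) (X theta eta : nat -> T -> R) :
  (forall n, 0 <= alpha n) -> cvgn (series alpha) ->
  (forall n t, 0 <= X n t) -> (forall n, adapted n (X n)) ->
  (forall n t, 0 <= eta n t) -> (forall n, adapted n (eta n)) ->
  (forall n t, 0 <= theta n t) -> (forall n, measurable_fun setT (theta n)) ->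
  (forall n A, <<s F n>> A ->
    (\int[P]_(t in A) (X n.+1 t + theta n t)%:E <=
     \int[P]_(t in A) ((1 + alpha n) * X n t + eta n t)%:E)%E) ->
  (\forall t \ae P, cvgn (series (eta^~ t))) ->
  \forall t \ae P, cvgn (X^~ t) /\ cvgn (series (theta^~ t)).
Proof.
move=> alpha0 alpha_cvg X0 Xad eta0 etad theta0 mtheta drift eta_cvg.
pose s := series alpha; pose c n := expR (- s n).
have c0 n : 0 < c n by exact: expR_gt0.
have s_nd : nondecreasing_seq s.
  by apply/nondecreasing_seqP => n; rewrite /s seriesSr lerDl.
have s_le n : s n <= limn s by exact: nondecreasing_cvgn_le.
have c_ge n : expR (- limn s) <= c n by rewrite ler_expR lerN2.
have c1 n : c n <= 1.
  by rewrite -expR0 ler_expR oppr_le0 /s /series/= sumr_ge0.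
have expNK x : expR (- x) * expR x = 1 :> R by rewrite -expRD addNr expR0.
have c_step n : c n.+1 * (1 + alpha n) <= c n.
  rewrite /c /s seriesSr -/s opprD expRD -mulrA -[leRHS]mulr1 ler_pM2l ?expR_gt0//.
  rewrite -[leRHS](expNK (alpha n)).
  by rewrite ler_pM2l ?expR_gt0// expR_ge1Dx.
have cscale k m (f : T -> R) : adapted m f -> adapted m (fun t => c k * f t).
  by move=> mf; apply: measurable_funM => //; exact: measurable_cst.
have mX j : measurable_fun setT (X j) by exact: sub_measurable_funT (@F_sub _) (@Xad j).
have meta n : measurable_fun setT (eta n).
  exact: sub_measurable_funT (@F_sub _) (@etad n).
have : \forall t \ae P, cvgn (fun n => c n * X n t) /\
                        cvgn (series (fun n => c n.+1 * theta n t)).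
  apply: (@robbins_siegmund_unweighted (fun n t => c n * X n t)
    (fun n t => c n.+1 * theta n t) (fun n t => c n.+1 * eta n t)).
  - by move=> n t; rewrite mulr_ge0// ltW.
  - by move=> n; exact: cscale.
  - by move=> n t; rewrite mulr_ge0// ltW.
  - by move=> n; exact: cscale.
  - by move=> n t; rewrite mulr_ge0// ltW.
  - by move=> n; exact: measurable_funM.
  - move=> n A FA; have mA := F_sub FA.
    have mAf (f : T -> R) : measurable_fun setT f ->
        measurable_fun A (fun t => (f t)%:E).
      by move=> mf; apply/measurable_EFinP; exact: measurable_funTS.
    have scale (f : T -> R) : (forall t, 0 <= f t) -> measurable_fun setT f ->
        (\int[P]_(t in A) (c n.+1 * f t)%:E = (c n.+1)%:E * \int[P]_(t in A) (f t)%:E)%E.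
      move=> f0 mf; rewrite -ge0_integralZl_EFin//.
      + by move=> t _; rewrite lee_fin.
      + exact: mAf.
      + exact: ltW.
    under eq_integral do rewrite -mulrDr.
    rewrite scale; last 2 first.
    + by move=> t; rewrite addr_ge0.
    + exact: measurable_funD.
    apply: (@le_trans _ _
      (\int[P]_(t in A) (c n.+1 * ((1 + alpha n) * X n t + eta n t))%:E)%E).
      rewrite scale; last 2 first.
      + by move=> t; rewrite addr_ge0// mulr_ge0// addr_ge0.
      + by apply: measurable_funD => //; exact: measurable_funM.
      by apply: lee_wpmul2l; [rewrite lee_fin ltW|exact: drift].
    apply: ge0_le_integral => //.
    + move=> t _; rewrite lee_fin mulr_ge0 ?(ltW (c0 _))//.
      by rewrite addr_ge0// mulr_ge0// addr_ge0.
    + apply: mAf; apply: measurable_funM => //.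
      by apply: measurable_funD => //; exact: measurable_funM.
    + by apply: mAf; apply: measurable_funD; exact: measurable_funM.
    + move=> t _; rewrite lee_fin mulrDr lerD2r mulrA ler_wpM2r//.
  - apply: filterS eta_cvg => t; apply: series_le_cvg => n //.
    + by rewrite mulr_ge0// ltW.
    + by rewrite ler_piMl.
apply: filterS => t [Xc thetac]; split.
  have -> : X^~ t = (fun n => expR (s n) * (c n * X n t)).
    by apply/funext => n; rewrite mulrA (mulrC (expR _)) expNK mul1r.
  apply: is_cvgM => //; apply/cvg_ex; exists (expR (limn s)).
  by apply: (cvg_comp _ _ alpha_cvg); exact: continuous_expR.
apply: (@series_le_cvg _ _ (expR (limn s) *: (fun n => c n.+1 * theta n t))) => //.
- by move=> n; rewrite /= mulr_ge0 ?expR_ge0// mulr_ge0// ltW.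
- move=> n /=; rewrite -[leLHS]mul1r [leRHS](mulrA (expR _)) ler_wpM2r//.
  rewrite -[leLHS](expNK (limn s)) mulrC.
  by rewrite ler_pM2l ?expR_gt0.
- exact: is_cvg_seriesZ.
Qed.

End supermartingale.

(** * One step of the iteration *)

Section forward_backward.
Variables (R : realType) (K : completeNormedModType R) (dot : {dot K for idfun}).
Hypothesis dot_norm : induces_norm dot.
Variables (A : K -> set K) (B : K -> K) (beta : R).
Hypothesis A_mono : monotone_operator dot A.
Hypotheses (beta_gt0 : 0 < beta) (B_coco : cocoercive dot beta B).
Variables (U W : {linear K -> K}) (M chi : R).
Hypotheses (M_gt0 : 0 < M) (U_bounded : forall x, `|U x| <= M * `|x|).
Hypotheses (W_sa : self_adjoint dot W) (UK : cancel U W).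
Hypotheses (chi_gt0 : 0 < chi) (W_bounded : forall x, `|W x| <= chi^-1 * `|x|).
Hypothesis W_pos : forall x, chi / M ^+ 2 * `|x| ^+ 2 <= dot (W x) x.

Let forward_identity (V : zmodType) (x x' z p u1 u2 u3 : V) :
  x - z - (u2 - u3) + p - (u1 - u2) = x' - z + (x + p - u1 - x' + u3).
Proof.
have -> : x - z - (u2 - u3) + p - (u1 - u2) = x + p - u1 + u3 - z.
  rewrite (addrAC (x - z)) -[LHS]addrA -opprD (addrC (u2 - u3)) subrKA opprB addrA.
  by rewrite [LHS](ACl (1*3*5*4*2)).
by rewrite [RHS]addrC (addrAC _ (- x') u3) subrKA.
Qed.

(** The squared norm for the inner product [<W x, y>], which makes [U A]
    monotone. *)
Definition energy x := dot (W x) x.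

Lemma coercivity_gt0 : 0 < chi / M ^+ 2.
Proof. by rewrite divr_gt0 ?exprn_gt0. Qed.

Lemma energy_ge0 x : 0 <= energy x.
Proof.
by apply: le_trans (W_pos x); rewrite mulr_ge0 ?exprn_ge0// ltW ?coercivity_gt0.
Qed.

Lemma energy_le x : energy x <= chi^-1 * `|x| ^+ 2.
Proof. by rewrite expr2; exact: (dot_bounded_op dot_norm x x W_bounded). Qed.

Lemma norm_le_energy x : `|x| ^+ 2 <= (chi / M ^+ 2)^-1 * energy x.
Proof. by rewrite ler_pdivlMl ?coercivity_gt0// W_pos. Qed.

Lemma energy_eq0 x : energy x = 0 -> x = 0.
Proof.
move=> x0; apply/eqP; rewrite -normr_eq0 -sqrf_eq0 eq_le exprn_ge0// andbT.
by have := norm_le_energy x; rewrite x0 mulr0.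
Qed.

Lemma energyD x y : energy (x + y) = energy x + 2 * dot (W x) y + energy y.
Proof.
by rewrite /energy [W _]linearD !dotE (W_sa y x) (dotC dot y); ring.
Qed.

Lemma energyB x y : energy (x - y) = energy x - 2 * dot (W x) y + energy y.
Proof.
rewrite energyD dotNr mulrN; congr (_ + _).
by rewrite /energy [W _]linearN dotNl dotNr opprK.
Qed.

Lemma energyZ a x : energy (a *: x) = a ^+ 2 * energy x.
Proof. by rewrite /energy [W _]linearZ !dotE mulrA expr2. Qed.

(** Since [2 <W p, q> <= energy p + energy q]. *)
Lemma energy_inertia (a : R) p q : 0 <= a <= 1 ->
  energy (p + a *: q) <= (1 + a) * energy p + 2 * a / chi * `|q| ^+ 2.
Proof.
move=> /andP[a0 a1].
have h : 0 <= energy (p + (-1) *: q) by exact: energy_ge0.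
rewrite energyD energyZ dotZr sqrrN expr1n mul1r in h.
rewrite energyD energyZ dotZr.
have hq := energy_le q; have q0 := energy_ge0 q.
have -> : 2 * a / chi * `|q| ^+ 2 = 2 * a * (chi^-1 * `|q| ^+ 2) by ring.
move: (chi^-1 * `|q| ^+ 2) (energy q) (energy p) (dot (W p) q) hq q0 h.
move=> Q eq ep pq hq q0 h.
have h1 : 0 <= a * (ep + 2 * (-1 * pq) + eq) by rewrite mulr_ge0.
have h2 : 0 <= a * (1 - a) * eq by rewrite !mulr_ge0// subr_ge0.
have h3 : 0 <= a * (Q - eq) by rewrite mulr_ge0// subr_ge0.
have h4 : a ^+ 2 * eq = a * eq - a * (1 - a) * eq by ring.
rewrite h4; nra.
Qed.

Lemma zeros_of_sumP z : zeros_of_sum A B z <-> A z (- B z).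
Proof.
split=> [[v Av /eqP]|Az]; first by rewrite addr_eq0 => /eqP <-.
by exists (- B z) => //; rewrite addNr.
Qed.

Section step.
Variables (g eps : R).
Hypotheses (eps_gt0 : 0 < eps) (eps_g : eps <= g) (gM : g * M <= (2 - eps) * beta).

Let g_gt0 : 0 < g. Proof. exact: lt_le_trans eps_g. Qed.

Lemma resolventP y x : resolvent (scaled_operator g U A) y x ->
  exists2 v, A x v & y = x + g *: U v.
Proof. by move=> [_ [v Av <-] <-]; exists v. Qed.

Lemma resolvent_lipschitz y y' x x' :
  resolvent (scaled_operator g U A) y x ->
  resolvent (scaled_operator g U A) y' x' ->
  `|x - x'| <= (chi / M ^+ 2)^-1 * chi^-1 * `|y - y'|.
Proof.
move=> /resolventP[v Av ->] /resolventP[v' Av' ->].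
set dy := x + _ - _.
have [->|xx'] := eqVneq x x'.
  by rewrite subrr normr0 !mulr_ge0 ?invr_ge0 ?(ltW coercivity_gt0)// ltW.
have nx : 0 < `|x - x'| by rewrite normr_gt0 subr_eq0.
have Wdy : W dy = W (x - x') + g *: (v - v').
  rewrite -(UK (v - v')) -linearZ -linearD /dy; congr (W _).
  by rewrite linearB/= scalerBr opprD addrACA.
have h : chi / M ^+ 2 * `|x - x'| ^+ 2 <= dot (W dy) (x - x').
  rewrite Wdy dotDl dotZl (le_trans (W_pos _))// lerDl mulr_ge0 ?(ltW g_gt0)//.
  exact: A_mono.
have := le_trans h (dot_le_norm dot_norm _ _).
rewrite expr2 mulrA ler_pM2r// => h2.
rewrite -mulrA ler_pdivlMl ?coercivity_gt0//.
exact: le_trans h2 (W_bounded _).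
Qed.

Variables (a : R) (x xp x' rr z : K).
Hypothesis a_itv : 0 <= a <= 1.
Hypothesis x'P : resolvent (scaled_operator g U A)
  (x + a *: (x - xp) - g *: U rr) x'.
Hypothesis zP : A z (- B z).

(** This is [g U (v + B z)], where [v] is the element of [A x'] selected by the
    resolvent; it measures how far [- B z] is from [A x']. *)
Definition residual := x + a *: (x - xp) - g *: U rr - x' + g *: U (B z).

(** The argument of the resolvent with [B x] in place of its estimate [rr], relative
    to the point [z - g U (B z)], which the resolvent maps to [z]. *)
Definition forward := x - z - g *: U (B x - B z) + a *: (x - xp).

(** Cocoercivity yields [- 2 g beta |b|^2] and the quadratic term at most
    [g^2 M |b|^2] for [b = B x - B z]; their sum is at most
    [- eps^2 beta |b|^2] because [g M <= (2 - eps) beta] and [g >= eps]. *)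
Lemma forward_energy :
  energy forward + eps ^+ 2 * beta * `|B x - B z| ^+ 2 <=
  (1 + a) * energy (x - z) + 2 * a / chi * `|x - xp| ^+ 2.
Proof.
set b := B x - B z.
have hb : energy (x - z - g *: U b) <= energy (x - z) - eps ^+ 2 * beta * `|b| ^+ 2.
  rewrite -scaleNr energyD energyZ dotZr W_sa UK /energy UK (dotC dot b).
  have h1 := B_coco x z; have h2 := dot_bounded_op dot_norm b b U_bounded.
  rewrite -/b in h1; rewrite -expr2 in h2; have b0 : 0 <= `|b| ^+ 2 by rewrite exprn_ge0.
  move: (dot (W (x - z)) (x - z)) (dot (x - z) b) (dot (U b) b) (`|b| ^+ 2) h1 h2 b0.
  move=> X Y Z N h1 h2 N0.
  have e1 : g ^+ 2 * Z <= g ^+ 2 * (M * N) by rewrite ler_wpM2l ?exprn_ge0 ?(ltW g_gt0).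
  have e2 : g * (g * M) * N <= g * ((2 - eps) * beta) * N.
    by rewrite ler_wpM2r// ler_wpM2l// ltW.
  have e3 : g * (beta * N) <= g * Y by rewrite ler_wpM2l// ltW.
  have e4 : eps * (eps * beta * N) <= g * (eps * beta * N).
    by rewrite ler_wpM2r// !mulr_ge0// ltW.
  nra.
apply: (@le_trans _ _ ((1 + a) * energy (x - z - g *: U b) +
    2 * a / chi * `|x - xp| ^+ 2 + eps ^+ 2 * beta * `|b| ^+ 2)).
  by rewrite lerD2r; exact: energy_inertia.
have /andP[a0 _] := a_itv.
have N0 : 0 <= eps ^+ 2 * beta * `|b| ^+ 2.
  by rewrite !mulr_ge0 ?exprn_ge0// ltW.
move: (eps ^+ 2 * beta * `|b| ^+ 2) (2 * a / chi * `|x - xp| ^+ 2)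
  (energy (x - z)) (energy (x - z - g *: U b)) hb N0 => N Q X Y hb N0.
nra.
Qed.

(** The firm nonexpansiveness of the resolvent in the metric of [W]. *)
Lemma step_energy :
  energy (x' - z) + energy residual <= energy (forward - g *: U (rr - B x)).
Proof.
have [v Av yE] := resolventP x'P.
have qE : residual = g *: U (v + B z).
  rewrite /residual yE [x' + _]addrC addrK.
  by rewrite linearD scalerDr.
have -> : forward - g *: U (rr - B x) = (x' - z) + residual.
  have UB u u' : g *: U (u - u') = g *: U u - g *: U u'.
    by rewrite linearB/= scalerBr.
  by rewrite /forward /residual !UB; exact: forward_identity.
have WqE : W residual = g *: (v + B z) by rewrite qE linearZ/= UK.
rewrite [leRHS]energyD lerD2r lerDl mulr_ge0// W_sa WqE dotZr.
by rewrite mulr_ge0 ?(ltW g_gt0)// dotC -[B z]opprK; exact: A_mono.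
Qed.

(** The one-step inequality behind the almost supermartingale property; [forward]
    depends on the past only, so that the last term on the left has zero
    conditional expectation. *)
Lemma energy_decrease (xi := rr - B x) :
  energy (x' - z) +
    (energy residual + eps ^+ 2 * beta * `|B x - B z| ^+ 2 + `|xi| ^+ 2) +
    2 * g * dot forward xi <=
  (1 + a) * energy (x - z) + 2 * a / chi * `|x - xp| ^+ 2 +
    ((2 * beta) ^+ 2 / M + 1) * `|xi| ^+ 2.
Proof.
have h1 := step_energy; have h2 := forward_energy; rewrite -/xi in h1.
rewrite -scaleNr (energyD forward) energyZ dotZr W_sa UK in h1.
have h3 : energy (U xi) <= M * `|xi| ^+ 2.
  by rewrite /energy UK dotC expr2; exact: dot_bounded_op.
have h4 : g ^+ 2 * M <= (2 * beta) ^+ 2 / M.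
  rewrite ler_pdivlMr// -mulrA -expr2 -exprMn.
  rewrite lerXn2r ?nnegrE ?mulr_ge0 ?(ltW g_gt0) ?(ltW M_gt0) ?(ltW beta_gt0)//.
  apply: le_trans gM _; rewrite ler_wpM2r ?(ltW beta_gt0)//.
  by rewrite gerBl ltW.
have h5 : (- g) ^+ 2 * energy (U xi) <= (2 * beta) ^+ 2 / M * `|xi| ^+ 2.
  rewrite sqrrN; apply: le_trans (ler_wpM2l _ h3) _; first by rewrite exprn_ge0 ?ltW.
  by rewrite mulrA ler_wpM2r// exprn_ge0.
rewrite mulrDl mul1r.
move: ((- g) ^+ 2 * energy (U xi)) h1 h5 h2 => eU h1 h5 h2.
by nra.
Qed.

End step.

(** * Passing to the limit along one trajectory *)

(** The graph of a maximally monotone operator is closed under bounded limits that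
    are weak in the points and strong in the images. *)
Lemma weak_limit_zero (F : set_system nat) (w v : nat -> K) (z l : K) (C : R) :
  maximally_monotone dot A -> ProperFilter F ->
  (forall n, A (w n.+1) (v n)) -> (forall n, `|w n| <= C) ->
  v n @[n --> F] --> - B z -> B (w n) @[n --> F] --> B z ->
  w n - w n.+1 @[n --> F] --> 0 ->
  (forall u, dot (w n) u @[n --> F] --> dot l u) ->
  A l (- B l) /\ B l = B z.
Proof.
move=> [_ A_max] FF Av wC vz Bz dw wl.
have wl1 u : dot (w n.+1) u @[n --> F] --> dot l u.
  rewrite -[dot l u]subr0.
  have -> : (fun n => dot (w n.+1) u) = (fun n => dot (w n) u - dot (w n - w n.+1) u).
    by apply/funext => n; rewrite -dotNl -dotDl opprB addrC subrK.
  apply: cvgB; first exact: wl.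
  by rewrite -(linear0l dot u); exact: cvg_dotl.
have Al : A l (- B z).
  (* Adding the pair [(l, - B z)] to the graph of [A] keeps it monotone. *)
  pose A' x := [set u | A x u \/ (x = l /\ u = - B z)].
  have mono x u : A x u -> 0 <= dot (- B z - u) (l - x).
    move=> Axu.
    have : dot (v n - u) (w n.+1 - x) @[n --> F] --> dot (- B z - u) (l - x).
      apply: (cvg_dot_strong_weak dot_norm (M := C + `|x|)).
      - by apply: cvgB => //; exact: cvg_cst.
      - by move=> n; rewrite (le_trans (ler_normB _ _))// lerD2r.
      - move=> y; rewrite dotDl dotNl; under eq_fun do rewrite dotDl dotNl.
        by apply: cvgB => //; exact: cvg_cst.
    by move=> /cvgr_to_ge; apply; apply: nearW => n; exact: A_mono.
  apply: (A_max A').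
  - move=> z1 z2 v1 v2 [A1|[-> ->]] [A2|[-> ->]].
    + exact: A_mono.
    + by rewrite -[v1 - _]opprB -[z1 - l]opprB dotNl dotNr opprK; exact: mono.
    + exact: mono.
    + by rewrite !subrr (linear0l dot).
  - by move=> x u Axu; left.
  - by right.
have BE : B l = B z.
  apply/eqP; rewrite eq_sym -subr_eq0 -normr_eq0 -sqrf_eq0.
  rewrite eq_le exprn_ge0// andbT -(pmulr_rle0 _ beta_gt0) -oppr_ge0.
  have Bc : B (w n) - B l @[n --> F] --> B z - B l.
    by apply: cvgB => //; exact: cvg_cst.
  have lim : dot (B (w n) - B l) (w n - l) - beta * `|B (w n) - B l| ^+ 2
      @[n --> F] --> - (beta * `|B z - B l| ^+ 2).
    rewrite -[X in _ --> X]add0r; apply: cvgB.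
      rewrite -(linear0r dot (B z - B l)).
      apply: (cvg_dot_strong_weak dot_norm (M := C + `|l|)) => //.
        by move=> n; rewrite (le_trans (ler_normB _ _))// lerD2r.
      move=> y; rewrite (linear0l dot) -(subrr (dot l y)).
      under eq_fun do rewrite dotDl dotNl.
      by apply: cvgB => //; exact: cvg_cst.
    apply: cvgM; first exact: cvg_cst.
    by rewrite expr2; under eq_fun do rewrite expr2; apply: cvgM; exact: cvg_norm.
  apply: (cvgr_to_ge lim); apply: nearW => n.
  by rewrite subr_ge0 dotC; exact: B_coco.
by rewrite BE.
Qed.

End forward_backward.

Lemma cvg_norm_sqr0 (R : realType) (K : normedModType R) (J : Type)
    (F : set_system J) {FF : Filter F} (f : J -> K) :
  `|f x| ^+ 2 @[x --> F] --> (0 : R) -> f x @[x --> F] --> 0.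
Proof.
move=> /cvgr0Pnorm_lt f2; apply/cvgr0Pnorm_lt => e e0.
have /f2 : 0 < e ^+ 2 by rewrite exprn_gt0.
apply: filterS => x; rewrite ger0_norm ?exprn_ge0//.
by rewrite ltr_sqr ?nnegrE// ltW.
Qed.

Section trajectory.
Variables (R : realType) (K : completeNormedModType R) (dot : {dot K for idfun}).
Hypothesis dot_norm : induces_norm dot.
Variables (A : K -> set K) (B : K -> K) (beta : R).
Hypothesis A_max : maximally_monotone dot A.
Hypotheses (beta_gt0 : 0 < beta) (B_coco : cocoercive dot beta B).
Variables (U W : {linear K -> K}) (M chi : R).
Hypotheses (M_gt0 : 0 < M) (U_bounded : forall x, `|U x| <= M * `|x|).
Hypotheses (W_sa : self_adjoint dot W) (UK : cancel U W).
Hypotheses (chi_gt0 : 0 < chi) (W_bounded : forall x, `|W x| <= chi^-1 * `|x|).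
Hypothesis W_pos : forall x, chi / M ^+ 2 * `|x| ^+ 2 <= dot (W x) x.
Variables (eps : R) (gamma alpha : nat -> R).
Hypotheses (eps_gt0 : 0 < eps) (eps_gamma : forall n, eps <= gamma n).
Hypothesis gammaM : forall n, gamma n * M <= (2 - eps) * beta.
Variables (w r : nat -> K).
Hypothesis w_rec : forall n, resolvent (scaled_operator (gamma n) U A)
  (w n + alpha n *: (w n - w n.-1) - gamma n *: U (r n)) (w n.+1).
Variables (L : set K) (zeta : nat -> K).
Hypotheses (L_closed : closed L) (L0 : L 0).
Hypothesis L_lin : forall s x y, L x -> L y -> L (x + s *: y).
Hypothesis w_L : forall n, L (w n).
Hypothesis zeta_dense : [set l | L l /\ A l (- B l)] `<=` closure (range zeta).
Hypothesis energy_cvg : forall j, cvgn (fun n => energy dot W (w n - zeta j)).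
Let res n :=
  residual B U (gamma n) (alpha n) (w n) (w n.-1) (w n.+1) (r n) (zeta 0%N).
Hypothesis residual_cvg : energy dot W (res n) @[n --> \oo] --> (0 : R).
Hypothesis B_cvg : `|B (w n) - B (zeta 0%N)| ^+ 2 @[n --> \oo] --> (0 : R).
Hypothesis noise_cvg : `|r n - B (w n)| ^+ 2 @[n --> \oo] --> (0 : R).
Hypothesis inertia_cvg : alpha n *: (w n - w n.-1) @[n --> \oo] --> (0 : K).

Let gamma_gt0 n : 0 < gamma n. Proof. exact: lt_le_trans (eps_gamma n). Qed.

Let gamma_le n : gamma n <= 2 * beta / M.
Proof.
rewrite ler_pdivlMr// (le_trans (gammaM n))// ler_wpM2r ?(ltW beta_gt0)//.
by rewrite gerBl ltW.
Qed.

Let A_mono : monotone_operator dot A. Proof. by case: A_max. Qed.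

Lemma trajectory_bounded : exists C, forall n, `|w n| <= C.
Proof.
have /cvg_seq_bounded [D [_ /(_ (D + 1))]] := @energy_cvg 0%N.
rewrite ltrDl ltr01 => /(_ isT) wD.
pose c := (chi / M ^+ 2)^-1.
have c0 : 0 <= c by rewrite invr_ge0 ltW// coercivity_gt0.
exists (1 + c * (D + 1) + `|zeta 0%N|) => n.
rewrite -(subrK (zeta 0%N) (w n)) (le_trans (ler_normD _ _))// lerD2r.
have h := norm_le_energy M_gt0 chi_gt0 W_pos (w n - zeta 0%N).
have h2 : energy dot W (w n - zeta 0%N) <= D + 1.
  by apply: le_trans (ler_norm _) _; exact: wD.
have h3 := ler_wpM2l c0 h2; rewrite -/c in h.
have h4 : 0 <= (`|w n - zeta 0%N| - 1) ^+ 2 by rewrite sqr_ge0.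
move: (`|w n - zeta 0%N|) h h4 (normr_ge0 (w n - zeta 0%N)) => X h h4 X0.
rewrite sqrrB expr1n mulr1 in h4.
nra.
Qed.

Lemma residual_to0 : res n @[n --> \oo] --> (0 : K).
Proof.
apply: cvg_norm_sqr0; pose c := (chi / M ^+ 2)^-1.
have h : c * energy dot W (res n) @[n --> \oo] --> (0 : R).
  by rewrite -[X in _ --> X](mulr0 c); apply: cvgM => //; exact: cvg_cst.
apply: (squeeze_cvgr _ _ h); last exact: cvg_cst.
by apply: nearW => n; rewrite exprn_ge0//=; exact: norm_le_energy.
Qed.

(** The step is the residual, up to the inertial term and to the image under
    [gamma n *: U] of [r n - B (w n)] and [B (w n) - B z]. *)
Lemma step_to0 : w n - w n.+1 @[n --> \oo] --> (0 : K).
Proof.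
have B0 : B (w n) - B (zeta 0%N) @[n --> \oo] --> (0 : K) by exact: cvg_norm_sqr0.
have xi0 : r n - B (w n) @[n --> \oo] --> (0 : K) by exact: cvg_norm_sqr0.
have gU0 : gamma n *: U (r n - B (zeta 0%N)) @[n --> \oo] --> (0 : K).
  apply/norm_cvg0P.
  have h : 2 * beta / M * (M * `|r n - B (w n) + (B (w n) - B (zeta 0%N))|)
      @[n --> \oo] --> (0 : R).
    rewrite -[X in _ --> X](mulr0 (2 * beta / M)); apply: cvgM; first exact: cvg_cst.
    rewrite -[X in _ --> X](mulr0 M); apply: cvgM; first exact: cvg_cst.
    by apply/norm_cvg0P; have := cvgD xi0 B0; rewrite addr0; apply.
  apply: (squeeze_cvgr _ _ h); last exact: cvg_cst.
  apply: nearW => n; rewrite normr_ge0/= subrKA normrZ.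
  by rewrite ler_pM// ger0_norm// ltW.
have -> : (fun n => w n - w n.+1) = (fun n => res n - alpha n *: (w n - w n.-1) +
    gamma n *: U (r n - B (zeta 0%N))).
  apply/funext => n; rewrite /res /residual.
  have -> : gamma n *: U (r n - B (zeta 0%N)) =
      gamma n *: U (r n) - gamma n *: U (B (zeta 0%N)).
    by rewrite linearB/= scalerBr.
  move: (alpha n *: _) (gamma n *: U (r n)) (gamma n *: U _) => p u1 u2.
  by rewrite addrA [RHS](ACl (1*4*(2*6)*(7*3)*(5*8)))/= !subrr !addr0.
rewrite -[X in _ --> X]addr0; apply: cvgD => //.
by rewrite -[X in _ --> X]subr0; apply: cvgB => //; exact: residual_to0.
Qed.

(** The deterministic part of the theorem: along almost every trajectory the
    elements [v n] of [A (w n.+1)] selected by the resolvent satisfy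
    [v n --> - B z], so that every weak cluster point is a zero, and Opial's
    lemma applies. *)
Lemma trajectory_limit :
  exists l, [/\ L l, A l (- B l), weakly_cvg dot w l &
               B (w n) @[n --> \oo] --> B l].
Proof.
have [C wC] := trajectory_bounded.
have /choice [v vP] : forall n, exists v, A (w n.+1) v /\
    res n = gamma n *: U (v + B (zeta 0%N)).
  move=> n; have [v Av yE] := resolventP (w_rec n).
  exists v; split => //; rewrite /res /residual yE [w n.+1 + _]addrC addrK.
  by rewrite linearD scalerDr.
have v_cvg : v n @[n --> \oo] --> - B (zeta 0%N).
  apply/subr_cvg0/norm_cvg0P.
  have h : eps^-1 * (chi^-1 * `|res n|) @[n --> \oo] --> (0 : R).
    rewrite -[X in _ --> X](mulr0 eps^-1); apply: cvgM; first exact: cvg_cst.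
    rewrite -[X in _ --> X](mulr0 chi^-1); apply: cvgM; first exact: cvg_cst.
    by apply/norm_cvg0P; exact: residual_to0.
  apply: (squeeze_cvgr _ _ h); last exact: cvg_cst.
  apply: nearW => n; rewrite normr_ge0/= opprK.
  have [_ resE] := vP n; rewrite ler_pdivlMl//; apply: le_trans (W_bounded _).
  rewrite resE linearZ/= UK normrZ ger0_norm ?(ltW (gamma_gt0 n))//.
  by rewrite ler_wpM2r.
have B_to : B (w n) @[n --> \oo] --> B (zeta 0%N).
  by apply/subr_cvg0; exact: cvg_norm_sqr0.
have dw := step_to0.
have cluster F l : ProperFilter F -> \oo `<=` F ->
    (forall u, dot (w n) u @[n --> F] --> dot l u) ->
    [/\ L l, A l (- B l) & B l = B (zeta 0%N)].
  move=> FF Foo wl.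
  have [Al Bl] : A l (- B l) /\ B l = B (zeta 0%N).
    apply: (weak_limit_zero dot_norm A_mono beta_gt0 B_coco A_max FF (v := v) (C := C)) wl => //.
    - by move=> n; case: (vP n).
    - exact: cvg_trans (cvg_app _ Foo) v_cvg.
    - exact: cvg_trans (cvg_app _ Foo) B_to.
    - exact: cvg_trans (cvg_app _ Foo) dw.
  split => //.
  exact: (weak_limit_closed_subspace dot_norm FF L_closed L0 L_lin w_L wl).
have [||l [Ll Al] wl] := opial dot_norm wC W_sa
    (energy_eq0 M_gt0 chi_gt0 W_pos) zeta_dense.
- by move=> F l FF Foo /(cluster F l FF Foo)[].
- move=> i j.
  have -> : (fun n => dot (w n) (W (zeta i - zeta j))) = (fun n =>
      - 2^-1 * (energy dot W (w n - zeta i) - energy dot W (w n - zeta j)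
        - energy dot W (zeta i) + energy dot W (zeta j))).
    apply/funext => n; rewrite !(energyB W_sa) -W_sa dotDr dotNr.
    move: (energy dot W (w n)) (energy dot W (zeta i)) (energy dot W (zeta j)).
    by move: (dot _ (zeta i)) (dot _ (zeta j)) => a b e ei ej; lra.
  apply: is_cvgM; first exact: is_cvg_cst.
  apply: is_cvgD; last exact: is_cvg_cst.
  apply: is_cvgB; last exact: is_cvg_cst.
  by apply: is_cvgB; exact: energy_cvg.
exists l; split => //.
have [//|_ _ ->] := cluster \oo l _ _ wl.
exact: B_to.
Qed.

End trajectory.

(** The pairing of the bounded [w n - l] with [B (w n) - B l --> 0] tends to zero
    and dominates [phi |w n - l|]; were [|w n - l| >= e] infinitely often, it would
    stay above [phi e > 0]. *)
Lemma uniformly_monotone_strong_cvg (R : realType) (K : normedModType R)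
    (dot : {dot K for idfun}) (B : K -> K) (w : nat -> K) (l : K) (C : R) :
  induces_norm dot -> uniformly_monotone_at dot B l -> (forall n, `|w n| <= C) ->
  B (w n) @[n --> \oo] --> B l -> `|w n - l| @[n --> \oo] --> (0 : R).
Proof.
move=> dot_norm [phi [phi_nd phi_ge0 phi_eq0 phiB]] wC Bw.
apply/norm_cvg0P/cvgr0Pnorm_lt => e e0.
have h : (C + `|l|) * `|B (w n) - B l| @[n --> \oo] --> (0 : R).
  rewrite -[X in _ --> X](mulr0 (C + `|l|)); apply: cvgM; first exact: cvg_cst.
  by apply/norm_cvg0P/subr_cvg0.
have dot_small n : dot (w n - l) (B (w n) - B l) <= (C + `|l|) * `|B (w n) - B l|.
  rewrite (le_trans (dot_le_norm dot_norm _ _))// ler_wpM2r//.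
  by rewrite (le_trans (ler_normB _ _))// lerD2r.
have phie : (0 < phi e)%E.
  rewrite lt_neqAle phi_ge0 ?(ltW e0)// andbT eq_sym; apply/eqP => /phi_eq0.
  by rewrite (ltW e0) => /(_ isT) e00; rewrite e00 ltxx in e0.
have [p p0 pe] : exists2 p : R, 0 < p & (p%:E <= phi e)%E.
  case: (phi e) phie => [p|_|//]; first by rewrite lte_fin; exists p.
  by exists 1; rewrite ?leey.
have /cvgr0Pnorm_lt/(_ p p0) := h; apply: filterS => n hn.
rewrite ltNge; apply/negP => ew.
have := le_trans pe (phi_nd _ _ (ltW e0) ew).
move=> /le_trans /(_ (phiB (w n))); rewrite lee_fin => /le_trans /(_ (dot_small n)).
by move=> /le_lt_trans /(_ (le_lt_trans (ler_norm _) hn)); rewrite ltxx.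
Qed.

(** * Filtrations and conditional expectations *)

Section natural_filtration.
Variables (R : realType) (K : normedModType R) (d : measure_display)
  (T : measurableType d) (w : nat -> T -> K).
Hypothesis w_meas : forall n, strongly_measurable measurable (w n).

Definition filtration_generator n : set (set T) :=
  \bigcup_(i in [set i | (i <= n)%N])
    preimage_set_system setT (w i) (<<s [set O : set K | open O] >>).

Lemma natural_filtration_sub n : <<s filtration_generator n >> `<=` measurable.
Proof.
apply: smallest_sub; first exact: sigma_algebra_measurable.
move=> _ [i _ [C sC <-]].
have mi : measurable_fun setT (w i : T -> g_sigma_algebraType [set O : set K | open O]).
  apply: (@measurability _ _ T (g_sigma_algebraType [set O : set K | open O])
    setT (w i) [set O : set K | open O]) => // _ [V oV <-].
  by rewrite setTI; case: (w_meas i) => mwi _; exact: mwi.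
exact: mi.
Qed.

Lemma natural_filtration_mono n :
  <<s filtration_generator n >> `<=` <<s filtration_generator n.+1 >>.
Proof.
by apply: sub_sigma_algebra2 => A [i /= ni Ai]; exists i => //=; exact: leqW.
Qed.

Lemma natural_filtration_adapted i n : (i <= n)%N ->
  approximable (T := g_sigma_algebraType (filtration_generator n)) (w i).
Proof.
move=> ni; apply: strongly_measurable_approximable.
have [_ wD] := w_meas i; split => // O oO.
apply: sub_sigma_algebra; exists i => //.
by exists O; [exact: sub_sigma_algebra|rewrite setTI].
Qed.

End natural_filtration.

Section conditional_expectation.
Variables (R : realType) (d : measure_display) (T : measurableType d)
  (P : probability T R) (G : set (set T)).
Hypothesis G_sub : G `<=` measurable.

Lemma cond_exp_dot_eq0 (K : normedModType R) (dot : {dot K for idfun})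
    (X Y : T -> K) (A : set T) (x : K) :
  induces_norm dot -> is_cond_exp P G X Y -> G A ->
  (\int[P]_(t in A) (dot x (X t - Y t))%:E = 0)%E.
Proof.
move=> dot_norm [Xi Yi _ XY] GA; have [v Xv Yv] := XY A GA.
have mA := G_sub GA.
have l_lin a u u' : dot x (a *: u + u') = a * dot x u + dot x u' by rewrite !dotE.
have l_bd u : `|dot x u| <= `|x| * `|u| by exact: abs_dot_le_norm.
have IX := bochner_integrable_functional l_lin l_bd Xi.
have IY := bochner_integrable_functional l_lin l_bd Yi.
under eq_integral do rewrite dotDr dotNr EFinB.
rewrite integralB//; last 2 first.
- exact: integrableS IX.
- exact: integrableS IY.
rewrite (is_bochner_integral_functional l_lin l_bd Xi mA Xv).
by rewrite (is_bochner_integral_functional l_lin l_bd Yi mA Yv) subee.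
Qed.

Lemma cond_exp_real (X Y : T -> R) :
  is_cond_exp (E := R^o) P G X Y ->
  [/\ P.-integrable setT (EFin \o X), P.-integrable setT (EFin \o Y) &
    forall A, G A -> (\int[P]_(t in A) (X t)%:E = \int[P]_(t in A) (Y t)%:E)%E].
Proof.
move=> [Xi Yi _ XY].
have l_lin (a : R) (u u' : R^o) : (a *: u + u' : R) = a * u + u' by [].
have l_bd (u : R^o) : `|u : R| <= 1 * `|u| by rewrite mul1r.
split => [||A GA].
- exact: (bochner_integrable_functional (l := fun u : R^o => u : R) l_lin l_bd Xi).
- exact: (bochner_integrable_functional (l := fun u : R^o => u : R) l_lin l_bd Yi).
- have [v Xv Yv] := XY A GA; have mA := G_sub GA.
  rewrite (is_bochner_integral_functional (l := fun u : R^o => u : R) l_lin l_bd Xi mA Xv).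
  by rewrite (is_bochner_integral_functional (l := fun u : R^o => u : R) l_lin l_bd Yi mA Yv).
Qed.

(** Conditional expectations are only determined up to null sets: the set where
    a version of the conditional expectation of [X >= 0] is negative is an event
    of [G], on which both integrals must vanish. *)
Lemma cond_exp_ge0 (X Y : T -> R) : (forall t, 0 <= X t) ->
  is_cond_exp (E := R^o) P G X Y -> \forall t \ae P, 0 <= Y t.
Proof.
move=> X0 XY; have [IX IY XYE] := cond_exp_real XY.
have [_ _ [mY _] _] := XY.
pose N := [set t | Y t < 0].
have GN : G N by apply: (mY [set y : R | y < 0]); exact: open_lt.
have mN := G_sub GN.
have I0 : (\int[P]_(t in N) `|(Y t)%:E| = 0)%E.
  apply/eqP; rewrite eq_le; apply/andP; split; last first.
    by apply: integral_ge0 => t _; exact: abse_ge0.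
  have -> : (\int[P]_(t in N) `|(Y t)%:E| = - \int[P]_(t in N) (Y t)%:E)%E.
    rewrite -integralN.
      by apply: eq_integral => t; rewrite inE => Yt; rewrite lte0_abs ?lte_fin.
    apply: integrable_add_def => //; apply: integrableS IY => //.
  rewrite leeNl oppe0 -XYE//.
  by apply: integral_ge0 => t _; rewrite lee_fin.
have mYN : measurable_fun N (EFin \o Y).
  by have /integrableP[h _] := integrableS measurableT mN (@subsetT _ _) IY.
have := (ae_eq_integral_abs P mN mYN).1 I0.
apply: filterS => t /= NY; rewrite leNgt; apply/negP => Yt.
by move: (NY Yt) => [Y0]; rewrite Y0 ltxx in Yt.
Qed.

End conditional_expectation.

Lemma cvg_series_of_nneseries (R : realType) (u : nat -> R) :
  (forall n, 0 <= u n) -> (\sum_(0 <= n <oo) (u n)%:E < +oo)%E -> cvgn (series u).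
Proof.
move=> u0 uoo; apply: nondecreasing_is_cvgn.
  by apply/nondecreasing_seqP => n; rewrite seriesSr lerDl.
exists (fine (\sum_(0 <= n <oo) (u n)%:E)%E) => _ [n _ <-].
have s0 : (0 <= \sum_(0 <= n <oo) (u n)%:E)%E.
  by apply: nneseries_ge0 => k _ _; rewrite lee_fin.
rewrite -lee_fin fineK ?ge0_fin_numE// /series/= -sumEFin.
by apply: nneseries_lim_ge => k _ _; rewrite lee_fin.
Qed.

Lemma operator_norm_le (R : realType) (K : normedModType R) (U : {linear K -> K}) :
  bounded_operator U -> forall x, `|U x| <= operator_norm U * `|x|.
Proof.
move=> [M UM] x; have [->|x0] := eqVneq x 0; first by rewrite linear0 !normr0 mulr0.
have nx : 0 < `|x| by rewrite normr_gt0.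
rewrite -ler_pdivrMr//.
have -> : `|U x| / `|x| = `|U (`|x|^-1 *: x)|.
  by rewrite linearZ normrZ/= ger0_norm ?invr_ge0// mulrC.
apply: ub_le_sup; last first.
  exists (`|x|^-1 *: x) => //=; rewrite normrZ ger0_norm ?invr_ge0//.
  by rewrite mulVf// gt_eqF.
exists `|M| => _ [y /= y1 <-]; apply: le_trans (UM y) _.
by rewrite (le_trans (ler_wpM2r _ (ler_norm M)))// ler_piMr.
Qed.

(** * The almost supermartingale property *)

Section stochastic_forward_backward.
Variables (R : realType) (K : completeNormedModType R) (dot : {dot K for idfun}).
Hypothesis dot_norm : induces_norm dot.
Variables (d : measure_display) (T : measurableType d) (P : probability T R).
Variables (A : K -> set K) (B : K -> K) (beta : R).
Hypothesis A_mono : monotone_operator dot A.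
Hypotheses (beta_gt0 : 0 < beta) (B_coco : cocoercive dot beta B).
Variables (U W : {linear K -> K}) (M chi : R).
Hypotheses (M_gt0 : 0 < M) (U_bounded : forall x, `|U x| <= M * `|x|).
Hypotheses (W_sa : self_adjoint dot W) (UK : cancel U W).
Hypotheses (chi_gt0 : 0 < chi) (W_bounded : forall x, `|W x| <= chi^-1 * `|x|).
Hypothesis W_pos : forall x, chi / M ^+ 2 * `|x| ^+ 2 <= dot (W x) x.
Variables (eps : R) (gamma alpha : nat -> R).
Hypotheses (eps_gt0 : 0 < eps) (eps_gamma : forall n, eps <= gamma n).
Hypothesis gammaM : forall n, gamma n * M <= (2 - eps) * beta.
Hypothesis alpha_itv : forall n, 0 <= alpha n <= 1.
Variables (w r : nat -> T -> K).
Hypothesis w0_meas : strongly_measurable measurable (w 0%N).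
Hypothesis w_rec : forall n t, resolvent (scaled_operator (gamma n) U A)
  (w n t + alpha n *: (w n t - w n.-1 t) - gamma n *: U (r n t)) (w n.+1 t).
Hypothesis r_unbiased : forall n,
  is_cond_exp P (natural_filtration w n) (r n) (B \o w n).
Variable V : nat -> T -> R.
Hypothesis V_cond : forall n, is_cond_exp (E := R^o) P (natural_filtration w n)
  (fun t => `|r n t - B (w n t)| ^+ 2) (V n).

Let r_approx n : approximable (r n).
Proof. by have [[mr _] _ _ _] := r_unbiased n; exact: strongly_measurable_approximable. Qed.

Let approximable_linear d' (S : measurableType d') (Q : {linear K -> K}) D
    (X : S -> K) :
  (forall x, `|Q x| <= D * `|x|) -> approximable X -> approximable (fun t => Q (X t)).
Proof.
move=> QD Xa; apply: (approximable_lipschitz (L := D) Xa) => t t'.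
by rewrite -linearB.
Qed.

(** The iterate is a Lipschitz function of the argument of the resolvent. *)
Lemma iterate_approximable n : approximable (w n).
Proof.
suff : approximable (w n.-1) /\ approximable (w n) by case.
elim: n => [|n [w1 w2]] /=.
  by split; exact: strongly_measurable_approximable.
split => //.
pose y t := w n t + alpha n *: (w n t - w n.-1 t) - gamma n *: U (r n t).
have ya : approximable y.
  apply: approximableB; last by apply/approximableZ/(approximable_linear U_bounded).
  by apply: approximableD => //; apply: approximableZ; exact: approximableB.
apply: (approximable_lipschitz ya) => t t'.
exact: (resolvent_lipschitz dot_norm A_mono M_gt0 UK chi_gt0 W_bounded W_pos
  eps_gt0 (eps_gamma n) (w_rec n t) (w_rec n t')).
Qed.

Let w_meas n : strongly_measurable measurable (w n).
Proof. exact/approximable_strongly_measurable/iterate_approximable. Qed.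

Let F_sub n : natural_filtration w n `<=` measurable.
Proof. exact: natural_filtration_sub. Qed.

Local Notation Fn n := (g_sigma_algebraType (filtration_generator w n)).

Let adapted_w n : approximable (T := Fn n) (w n).
Proof. exact: natural_filtration_adapted. Qed.

Let adapted_wp n : approximable (T := Fn n) (w n.-1).
Proof. by apply: natural_filtration_adapted => //; exact: leq_pred. Qed.

Let adapted_Bw n : approximable (T := Fn n) (fun t => B (w n t)).
Proof.
have [_ _ mB _] := r_unbiased n.
exact: (@strongly_measurable_approximable _ _ (Fn n) _ _ mB).
Qed.

Let approximable_sub n (X : T -> K) : approximable (T := Fn n) X -> approximable X.
Proof.
move=> Xa; apply: strongly_measurable_approximable.
have [mX XD] := approximable_strongly_measurable Xa; split => // O oO.
by apply: F_sub; exact: mX.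
Qed.

Let xi n t := r n t - B (w n t).

Let xi_approx n : approximable (xi n).
Proof. by apply: approximableB => //; exact: approximable_sub (adapted_Bw n). Qed.

(** A version [V n] of the conditional variance may be negative on a null set, hence
    the truncation. *)
Definition increment_cost n t :=
  2 * alpha n / chi * `|w n t - w n.-1 t| ^+ 2 +
  ((2 * beta) ^+ 2 / M + 1) * Num.max (V n t) 0.

Definition step_gain z n t :=
  energy dot W (residual B U (gamma n) (alpha n) (w n t) (w n.-1 t) (w n.+1 t) (r n t) z)
  + eps ^+ 2 * beta * `|B (w n t) - B z| ^+ 2 + `|xi n t| ^+ 2.

Let V_adapted n : measurable_fun [set: Fn n] (V n : Fn n -> R).
Proof.
have [_ _ mV _] := V_cond n.
have Va := @strongly_measurable_approximable _ _ (Fn n) R^o _ mV.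
by apply: (approximable_continuous_measurable (f := fun x : R^o => (x : R)) Va) => x;
  exact: cvg_id.
Qed.

Let energy_measurable d' (S : measurableType d') (X : S -> K) : approximable X ->
  measurable_fun setT (fun t => energy dot W (X t)).
Proof.
move=> Xa; apply: approximable_dot => //.
apply: (approximable_lipschitz (L := chi^-1) Xa) => t t'.
by rewrite -linearB.
Qed.

Lemma energy_adapted z n :
  measurable_fun [set: Fn n] ((fun t => energy dot W (w n t - z)) : Fn n -> R).
Proof.
apply: energy_measurable; apply: approximableB; first exact: adapted_w.
exact: approximable_cst.
Qed.

Let cost_coef_ge0 : 0 <= (2 * beta) ^+ 2 / M + 1.
Proof. by rewrite addr_ge0// divr_ge0 ?exprn_ge0 ?mulr_ge0// ltW. Qed.

Let alpha_ge0 n : 0 <= alpha n. Proof. by have /andP[] := alpha_itv n. Qed.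

Lemma increment_cost_ge0 n t : 0 <= increment_cost n t.
Proof.
rewrite addr_ge0// mulr_ge0 ?le_max ?lexx ?orbT ?exprn_ge0//.
by rewrite divr_ge0 ?mulr_ge0// ltW.
Qed.

Let increment_sqr_adapted n :
  measurable_fun [set: Fn n] ((fun t => `|w n t - w n.-1 t| ^+ 2) : Fn n -> R).
Proof.
apply: measurable_funX; apply: approximable_norm; apply: approximableB.
  exact: adapted_w.
exact: adapted_wp.
Qed.

Lemma increment_cost_adapted n :
  measurable_fun [set: Fn n] (increment_cost n : Fn n -> R).
Proof.
apply: measurable_funD; apply: measurable_funM => //.
apply: measurable_maxr => //; exact: V_adapted.
Qed.

Lemma step_gain_ge0 z n t : 0 <= step_gain z n t.
Proof.
have := energy_ge0 M_gt0 chi_gt0 W_pos.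
rewrite /step_gain => E0; rewrite !addr_ge0 ?exprn_ge0//.
by rewrite !mulr_ge0 ?exprn_ge0// ltW.
Qed.

Lemma step_gain_measurable z n : measurable_fun setT (step_gain z n).
Proof.
have wa := iterate_approximable.
have Bwa : approximable (fun t => B (w n t)) by exact: approximable_sub (adapted_Bw n).
have ca c : approximable (fun=> c : K) by move=> c'; exact: approximable_cst.
apply: measurable_funD; last exact/measurable_funX/approximable_norm.
apply: measurable_funD.
  apply: energy_measurable; apply: approximableD; last exact: approximable_cst.
  apply: approximableB => //; apply: approximableB.
    by apply: approximableD => //; apply: approximableZ; exact: approximableB.
  by apply: approximableZ; exact: approximable_linear U_bounded _.
apply: measurable_funM => //; apply: measurable_funX; apply: approximable_norm.
by apply: approximableB => //; exact: approximable_cst.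
Qed.

(** The part of the one-step inequality that is linear in the noise integrates to
    zero over every event of the past.  If the right-hand side is finite, then
    [forward] is square integrable on [C], so that this linear part is integrable. *)
Lemma energy_drift z n C : A z (- B z) -> natural_filtration w n C ->
  (\int[P]_(t in C) (energy dot W (w n.+1 t - z) + step_gain z n t)%:E <=
   \int[P]_(t in C)
     ((1 + alpha n) * energy dot W (w n t - z) + increment_cost n t)%:E)%E.
Proof.
move=> Az FC; have mC := F_sub FC.
pose G t := (1 + alpha n) * energy dot W (w n t - z) +
  2 * alpha n / chi * `|w n t - w n.-1 t| ^+ 2.
pose c := (2 * beta) ^+ 2 / M + 1.
pose a t := forward B U (gamma n) (alpha n) (w n t) (w n.-1 t) z.
have step t := energy_decrease dot_norm A_mono beta_gt0 B_coco M_gt0 U_bounded W_sa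
  UK chi_gt0 W_bounded W_pos eps_gt0 (eps_gamma n) (gammaM n) (alpha_itv n)
  (w_rec n t) Az.
have mE k : measurable_fun setT (fun t => energy dot W (w k t - z)).
  exact: sub_measurable_funT (@F_sub k) (@energy_adapted z k).
have mG : measurable_fun setT G.
  apply: measurable_funD; apply: measurable_funM => //.
  exact: sub_measurable_funT (@F_sub n) (@increment_sqr_adapted n).
have E0 := energy_ge0 M_gt0 chi_gt0 W_pos.
have G0 t : 0 <= G t.
  rewrite addr_ge0// mulr_ge0 ?exprn_ge0 ?addr_ge0//.
  by rewrite divr_ge0 ?mulr_ge0// ltW.
have c0 : 0 <= c := cost_coef_ge0.
have mV : measurable_fun setT (fun t => Num.max (V n t) 0).
  by apply: measurable_maxr => //; exact: sub_measurable_funT (@F_sub n) (@V_adapted n).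
have V0 t : 0 <= Num.max (V n t) 0 by rewrite le_max lexx orbT.
have mCE (f : T -> R) : measurable_fun setT f -> measurable_fun C (fun t => (f t)%:E).
  by move=> mf; apply/measurable_EFinP; exact: measurable_funTS.
have -> : (\int[P]_(t in C)
    ((1 + alpha n) * energy dot W (w n t - z) + increment_cost n t)%:E =
    \int[P]_(t in C) (G t)%:E + c%:E * \int[P]_(t in C) (Num.max (V n t) 0)%:E)%E.
  rewrite -ge0_integralZl_EFin//; last 2 first.
  - by move=> t _; rewrite lee_fin.
  - exact: mCE.
  rewrite -ge0_integralD//; last 4 first.
  - by move=> t _; rewrite lee_fin.
  - exact: mCE.
  - by move=> t _; rewrite -EFinM lee_fin mulr_ge0.
  - by apply: (mCE (fun t => c * Num.max (V n t) 0)); exact: measurable_funM.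
  by apply: eq_integral => t _; rewrite -EFinM -EFinD /G /increment_cost addrA.
have [GC|GC] := eqVneq (\int[P]_(t in C) (G t)%:E)%E +oo%E.
  rewrite GC addye ?leey// gt_eqF// (@lt_le_trans _ _ 0%E)// mule_ge0//.
  by apply: integral_ge0 => t _; rewrite lee_fin.
have iG : P.-integrable C (fun t => (G t)%:E).
  apply/integrableP; split; first exact: mCE.
  under eq_integral do rewrite gee0_abs ?lee_fin//.
  by rewrite ltey.
have [ixi2 iV xiV] := cond_exp_real (@F_sub n) (V_cond n).
have ixi2C : P.-integrable C (fun t => (`|xi n t| ^+ 2)%:E) by exact: integrableS ixi2.
have ixi : P.-integrable C (fun t => (`|xi n t|)%:E).
  apply: (@le_integrable _ _ _ _ _ mC _ (fun t => 1%:E + (`|xi n t| ^+ 2)%:E)%E).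
  - by apply: mCE; exact: approximable_norm.
  - move=> t _; rewrite -EFinD /= lee_fin normr_id ger0_norm; last first.
      by rewrite addr_ge0 ?exprn_ge0.
    by have := sqr_ge0 (`|xi n t| - 1); have := normr_ge0 (xi n t); nra.
  - by apply: integrableD => //; exact: finite_measure_integrable_cst.
have aa : approximable (T := Fn n) a.
  apply: approximableD; last first.
    by apply: approximableZ; apply: approximableB; [exact: adapted_w|exact: adapted_wp].
  apply: approximableB.
    by apply: approximableB; [exact: adapted_w|exact: approximable_cst].
  apply: approximableZ; apply: approximable_linear U_bounded _.
  by apply: approximableB; [exact: adapted_Bw|exact: approximable_cst].
pose k := (chi / M ^+ 2)^-1.
have k0 : 0 <= k by rewrite invr_ge0 ltW// coercivity_gt0.
have a_le t : `|a t| ^+ 2 <= k * G t.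
  apply: le_trans (norm_le_energy M_gt0 chi_gt0 W_pos _) _.
  rewrite ler_wpM2l//; apply: le_trans (forward_energy dot_norm beta_gt0 B_coco
    M_gt0 U_bounded W_sa UK chi_gt0 W_bounded W_pos eps_gt0 (eps_gamma n) (gammaM n)
    _ _ z (alpha_itv n)).
  by rewrite lerDl !mulr_ge0 ?exprn_ge0// ltW.
have iaxi : P.-integrable C (fun t => (dot (a t) (xi n t))%:E).
  apply: (@le_integrable _ _ _ _ _ mC _
    (fun t => k%:E * (G t)%:E + (`|xi n t| ^+ 2)%:E)%E).
  - by apply: mCE; apply: approximable_dot => //; exact: approximable_sub aa.
  - move=> t _; rewrite -EFinM -EFinD /= lee_fin [leRHS]ger0_norm; last first.
      by rewrite addr_ge0 ?exprn_ge0 ?mulr_ge0.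
    apply: le_trans (abs_dot_le_norm dot_norm _ _) _.
    apply: (@le_trans _ _ (`|a t| ^+ 2 + `|xi n t| ^+ 2)); last by rewrite lerD2r.
    by have := sqr_ge0 (`|a t| - `|xi n t|); have := normr_ge0 (a t);
      have := normr_ge0 (xi n t); nra.
  - by apply: integrableD => //; exact: integrableZl.
have axi0 : (\int[P]_(t in C) (dot (a t) (xi n t))%:E = 0)%E.
  apply: (integral_dot_eq0 dot_norm (@F_sub n)) => //.
  by move=> D x FD; exact: (cond_exp_dot_eq0 (@F_sub n) x dot_norm (r_unbiased n) FD).
apply: (@le_trans _ _ (\int[P]_(t in C) ((G t)%:E + c%:E * (`|xi n t| ^+ 2)%:E
    - (2 * gamma n)%:E * (dot (a t) (xi n t))%:E))%E).
  apply: ge0_le_integral => //.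
  - by move=> t _; rewrite lee_fin addr_ge0// step_gain_ge0.
  - by apply: mCE; apply: measurable_funD => //; exact: step_gain_measurable.
  - apply: emeasurable_funB; last first.
      by apply: emeasurable_funM => //; have /integrableP[] := iaxi.
    apply: emeasurable_funD; first exact: mCE.
    by apply: emeasurable_funM => //; have /integrableP[] := ixi2C.
  - move=> t _; rewrite -!EFinM -?EFinD -?EFinB lee_fin.
    by rewrite lerBrDr; exact: step.
rewrite integralB//; last 2 first.
- by apply: integrableD => //; exact: integrableZl.
- exact: integrableZl.
rewrite integralZl// axi0 mule0 sube0 integralD//; last exact: integrableZl.
rewrite integralZl//; apply: leeD => //; apply: lee_wpmul2l; first by rewrite lee_fin.
rewrite (xiV _ FC); apply: le_integral => //.
- exact: integrableS iV.
- apply: (@le_integrable _ _ _ _ _ mC _ (EFin \o V n)).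
  + exact: mCE.
  + move=> t _ /=; rewrite lee_fin ger0_norm// ge_max ler_norm normr_ge0//.
  + exact: integrableS iV.
- by move=> t _; rewrite lee_fin le_max lexx.
Qed.

Lemma energy_cvg z : A z (- B z) -> cvgn (series alpha) ->
  (\forall t \ae P, cvgn (series (fun n => increment_cost n t))) ->
  \forall t \ae P, cvgn (fun n => energy dot W (w n t - z)) /\
                   cvgn (series (fun n => step_gain z n t)).
Proof.
move=> Az alpha_cvg cost_cvg.
apply: (@robbins_siegmund _ _ _ P (filtration_generator w) _ _ alpha
  (fun n t => energy dot W (w n t - z)) (step_gain z) increment_cost) => //.
- exact: natural_filtration_mono.
- by move=> n t; exact: energy_ge0 M_gt0 chi_gt0 W_pos _.
- exact: energy_adapted.
- exact: increment_cost_ge0.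
- exact: increment_cost_adapted.
- exact: step_gain_ge0.
- exact: step_gain_measurable.
- by move=> n C FC; exact: energy_drift.
Qed.

End stochastic_forward_backward.

(** * The theorem *)

Theorem theorem3p2 (R : realType) (K : completeNormedModType R)
  (dot : {dot K for idfun}) (dot_norm : induces_norm dot)
  (d : measure_display) (T : measurableType d) (P : probability T R)
  (A : K -> set K) (A_max : maximally_monotone dot A)
  (beta : R) (beta_gt0 : 0 < beta)
  (B : K -> K) (B_coco : cocoercive dot beta B)
  (zeros_neq0 : zeros_of_sum A B !=set0)
  (U : {linear K -> K}) (U_bounded : bounded_operator U)
  (U_sa : self_adjoint dot U) (U_pos : strongly_positive dot U)
  (eps : R)
  (eps_itv : 0 < eps < Num.min 1 (beta * (operator_norm U)^-1))
  (gamma : nat -> R)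
  (gamma_itv : forall n,
     eps <= gamma n <= (2 - eps) * beta * (operator_norm U)^-1)
  (alpha : nat -> R) (alpha_itv : forall n, 0 <= alpha n <= 1 - eps)
  (r : nat -> T -> K) (r_sq : forall n, square_integrable P (r n))
  (w z : nat -> T -> K) (w0_sq : square_integrable P (w 0%N))
  (* w n.-1 is w_0 when n = 0, as prescribed by w_{-1} = w_0 *)
  (z_def : forall n t, z n t = w n t + alpha n *: (w n t - w n.-1 t))
  (w_rec : forall n t,
     resolvent (scaled_operator (gamma n) U A)
       (z n t - gamma n *: U (r n t)) (w n.+1 t))
  (r_unbiased : forall n,
     is_cond_exp P (natural_filtration w n) (r n) (B \o w n))
  (V : nat -> T -> R)
  (V_cond : forall n,
     is_cond_exp (E := R^o) P (natural_filtration w n)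
       (fun t => `|r n t - B (w n t)| ^+ 2) (V n))
  (V_summable : \forall t \ae P, (\sum_(0 <= n <oo) (V n t)%:E < +oo)%E)
  (w_incr : \forall t \ae P,
     (ereal_sup (range (fun n => `|w n t - w n.-1 t|%:E)) < +oo)%E)
  (alpha_summable : (\sum_(0 <= n <oo) (alpha n)%:E < +oo)%E) :
  exists wbar : T -> K,
    [/\ strongly_measurable measurable wbar,
        \forall t \ae P, zeros_of_sum A B (wbar t),
        \forall t \ae P, weakly_cvg dot (fun n => w n t) (wbar t),
        \forall t \ae P, B (w n t) @[n --> \oo] --> B (wbar t) &
        (\forall t \ae P, uniformly_monotone_at dot B (wbar t)) ->
        \forall t \ae P, `|w n t - wbar t| @[n --> \oo] --> (0 : R)].
Proof.
set M := operator_norm U in eps_itv gamma_itv.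
have /andP[eps_gt0] := eps_itv; rewrite lt_min => /andP[eps_lt1 epsM].
have M_gt0 : 0 < M.
  by have := lt_trans eps_gt0 epsM; rewrite pmulr_rgt0// invr_gt0.
have U_le := operator_norm_le U_bounded; rewrite -/M in U_le.
have [chi chi_gt0 U_chi] := U_pos.
have [W [_ UK W_sa W_le W_pos]] :=
  strongly_positive_inverse dot_norm U_le U_sa M_gt0 chi_gt0 U_chi.
have A_mono : monotone_operator dot A by case: A_max.
have eps_gamma n : eps <= gamma n by have /andP[] := gamma_itv n.
have gammaM n : gamma n * M <= (2 - eps) * beta.
  by have /andP[_] := gamma_itv n; rewrite ler_pdivlMr.
have alpha01 n : 0 <= alpha n <= 1.
  have /andP[-> a1] := alpha_itv n; rewrite (le_trans a1)//.
  by rewrite gerBl ltW.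
have alpha_ge0 n : 0 <= alpha n by have /andP[] := alpha01 n.
have {}w_rec n t : resolvent (scaled_operator (gamma n) U A)
    (w n t + alpha n *: (w n t - w n.-1 t) - gamma n *: U (r n t)) (w n.+1 t).
  by rewrite -z_def.
have w0_meas : strongly_measurable measurable (w 0%N) by case: w0_sq.
have w_approx n : approximable (w n).
  exact: (iterate_approximable dot_norm A_mono M_gt0 U_le UK chi_gt0 W_le W_pos
    eps_gt0 eps_gamma w0_meas w_rec r_unbiased).
have w_meas n := approximable_strongly_measurable (w_approx n).
have F_sub n : natural_filtration w n `<=` measurable by exact: natural_filtration_sub.
have alpha_cvg := cvg_series_of_nneseries alpha_ge0 alpha_summable.
have incr_bounded : \forall t \ae P, exists m, forall n, `|w n t - w n.-1 t| <= m.
  apply: filterS w_incr => t; set s := ereal_sup _ => s_oo.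
  have s_ge n : (`|w n t - w n.-1 t|%:E <= s)%E by apply: ereal_sup_ubound; exists n.
  have s_fin : s \is a fin_num.
    by rewrite ge0_fin_numE// (le_trans _ (s_ge 0%N))// lee_fin.
  by exists (fine s) => n; rewrite -lee_fin fineK.
have V_ge0 : \forall t \ae P, forall n, 0 <= V n t.
  apply: ae_foralln => n; apply: (cond_exp_ge0 (F_sub n) _ (V_cond n)) => t.
  by rewrite exprn_ge0.
pose c := (2 * beta) ^+ 2 / M + 1.
have c_ge0 : 0 <= c by rewrite addr_ge0// divr_ge0 ?exprn_ge0 ?mulr_ge0// ltW.
have cost_cvg : \forall t \ae P,
    cvgn (series (fun n => increment_cost beta M chi alpha w V n t)).
  apply: filterS3 incr_bounded V_ge0 V_summable => t [m tm] Vt Vsum.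
  have V_cvg := cvg_series_of_nneseries Vt Vsum.
  have m_ge0 : 0 <= m by apply: le_trans (tm 0%N).
  apply: (@series_le_cvg _ _ (fun n => (2 / chi * m ^+ 2) *: alpha n + c *: V n t)).
  - by move=> n; exact: increment_cost_ge0.
  - move=> n; apply: addr_ge0; apply: mulr_ge0 => //.
    by rewrite mulr_ge0 ?exprn_ge0// divr_ge0 ?ltW.
  - move=> n; rewrite /increment_cost (max_idPl (Vt n)) lerD2r.
    have -> : (2 / chi * m ^+ 2) *: alpha n = 2 * alpha n / chi * m ^+ 2 :> R.
      by rewrite /GRing.scale/=; ring.
    rewrite ler_wpM2l ?divr_ge0 ?mulr_ge0 ?(ltW chi_gt0)//.
    by rewrite lerXn2r ?nnegrE.
  - by apply: is_cvg_seriesD; exact: is_cvg_seriesZ.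
(* All the iterates live in the separable closed subspace [L], and [zeta] is a
   sequence of zeros that is dense among the zeros in [L]; [z0] is there in case
   [L] contains no zero. *)
have [z0 /zeros_of_sumP z0_zero] := zeros_neq0.
have /choice [D D_P] : forall n, exists D, countable D /\ range (w n) `<=` closure D.
  by move=> n; have [_ [D Dc wD]] := w_meas n; exists D.
have [x [L0 L_lin L_D]] := separable_span (fun n => (D_P n).1).
set L := closure (range x) in L0 L_lin L_D.
have L_closed : closed L by exact: closed_closure.
have L_x (l : K) (e : R) : L l -> 0 < e -> exists j, `|l - x j| < e.
  move=> Ll e0; have [|_ [[j _ <-]]] := Ll (ball l e); first exact: nbhsx_ballx.
  by rewrite -ball_normE; exists j.
have w_L t n : L (w n t) by apply: L_D; apply: (D_P n).2; exists t.
have range_x : countable (range x).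
  by apply: sub_countable (card_image_le _ _) _; exact: countableP.
have [zeta [zetaP zeta_near]] := separable_subset z0 range_x
  (fun l (Ll : [set l | L l /\ A l (- B l)] l) => Ll.1).
have zeta_zero j : A (zeta j) (- B (zeta j)) by case: (zetaP j) => [->|[]].
have zeta_dense : [set l | L l /\ A l (- B l)] `<=` closure (range zeta).
  move=> l Sl O /nbhs_ballP[e /= e0 eO]; have [j lj] := zeta_near _ _ Sl e0.
  by exists (zeta j); split; [exists j|apply: eO; rewrite -ball_normE].
have gain_cvg : \forall t \ae P, forall j,
    cvgn (fun n => energy dot W (w n t - zeta j)) /\
    cvgn (series (fun n =>
      step_gain dot B beta U W eps gamma alpha w r (zeta j) n t)).
  apply: ae_foralln => j.
  exact: (energy_cvg dot_norm A_mono beta_gt0 B_coco M_gt0 U_le W_sa UK chi_gt0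
    W_le W_pos eps_gt0 eps_gamma gammaM alpha01 w0_meas w_rec r_unbiased V_cond
    (zeta_zero j) alpha_cvg cost_cvg).
(* [N] is a measurable null set that contains all the bad outcomes. *)
have [N [mN PN goodN]] := filterI gain_cvg incr_bounded.
have good t : ~ N t -> (forall j, cvgn (fun n => energy dot W (w n t - zeta j)) /\
    cvgn (series (fun n =>
      step_gain dot B beta U W eps gamma alpha w r (zeta j) n t))) /\
    exists m, forall n, `|w n t - w n.-1 t| <= m.
  by move=> Nt; apply: contrapT => bad; exact: Nt (goodN t bad).
have aeN : \forall t \ae P, ~ N t.
  by exists N; split => // t; rewrite /= notK.
have limit t : ~ N t -> (exists l, [/\ L l, A l (- B l),
    weakly_cvg dot (fun n => w n t) l & B (w n t) @[n --> \oo] --> B l]) /\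
    exists C, forall n, `|w n t| <= C.
  move=> /good[gain [m tm]].
  have gain0 := (gain 0%N).2.
  have to0 (f : nat -> R) : (forall n, 0 <= f n) -> (exists k, 0 <= k /\
      forall n, f n <= k * step_gain dot B beta U W eps gamma alpha w r (zeta 0%N) n t) ->
      f n @[n --> \oo] --> (0 : R).
    move=> f0 [k [k0 fk]].
    have h : k * step_gain dot B beta U W eps gamma alpha w r (zeta 0%N) n t
        @[n --> \oo] --> (0 : R).
      rewrite -[X in _ --> X](mulr0 k); apply: cvgM; first exact: cvg_cst.
      exact: cvg_series_cvg_0.
    apply: (squeeze_cvgr _ _ h); last exact: cvg_cst.
    by apply: nearW => n; rewrite f0 fk.
  have E0 := energy_ge0 M_gt0 chi_gt0 W_pos.
  have q0 : 0 < eps ^+ 2 * beta by rewrite mulr_gt0 ?exprn_gt0.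
  have p1 n : 0 <= energy dot W (residual B U (gamma n) (alpha n) (w n t)
    (w n.-1 t) (w n.+1 t) (r n t) (zeta 0%N)) by exact: E0.
  have p2 n : 0 <= eps ^+ 2 * beta * `|B (w n t) - B (zeta 0%N)| ^+ 2.
    by rewrite mulr_ge0 ?exprn_ge0// ltW.
  have p3 n : 0 <= `|r n t - B (w n t)| ^+ 2 by rewrite exprn_ge0.
  have residual0 : energy dot W (residual B U (gamma n) (alpha n) (w n t)
      (w n.-1 t) (w n.+1 t) (r n t) (zeta 0%N)) @[n --> \oo] --> (0 : R).
    apply: to0 => //; exists 1; split => // n; rewrite mul1r /step_gain -addrA lerDl.
    by rewrite addr_ge0.
  have B0 : `|B (w n t) - B (zeta 0%N)| ^+ 2 @[n --> \oo] --> (0 : R).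
    apply: to0 => [n|]; first by rewrite exprn_ge0.
    exists (eps ^+ 2 * beta)^-1; split => [|n]; first by rewrite invr_ge0 ltW.
    rewrite ler_pdivlMl// /step_gain -addrA addrCA lerDl.
    by rewrite addr_ge0.
  have noise0 : `|r n t - B (w n t)| ^+ 2 @[n --> \oo] --> (0 : R).
    apply: to0 => //; exists 1; split => // n; rewrite mul1r /step_gain lerDr.
    by rewrite addr_ge0.
  have inertia0 : alpha n *: (w n t - w n.-1 t) @[n --> \oo] --> (0 : K).
    apply/norm_cvg0P.
    have h : alpha n * m @[n --> \oo] --> (0 : R).
      rewrite -[X in _ --> X](mul0r m); apply: cvgM; last exact: cvg_cst.
      exact: cvg_series_cvg_0.
    apply: (squeeze_cvgr _ _ h); last exact: cvg_cst.
    by apply: nearW => n; rewrite normr_ge0/= normrZ ger0_norm// ler_wpM2l.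
  have energies j : cvgn (fun n => energy dot W (w n t - zeta j)).
    exact: (gain j).1.
  split; last exact: (trajectory_bounded M_gt0 chi_gt0 W_pos energies).
  exact: (trajectory_limit dot_norm A_max beta_gt0 B_coco M_gt0 U_le W_sa
    UK chi_gt0 W_le W_pos eps_gt0 eps_gamma gammaM (fun n => w_rec n t) L_closed
    L0 L_lin (w_L t) zeta_dense energies residual0 B0 noise0 inertia0).
have /choice [wbar wbarP] : forall t, exists l, L l /\ (N t -> l = 0) /\
    (~ N t -> [/\ A l (- B l), weakly_cvg dot (fun n => w n t) l &
                  B (w n t) @[n --> \oo] --> B l]).
  move=> t; have [Nt|Nt] := pselect (N t).
    by exists 0; split => //; split.
  by have [[l [Ll Al wl Bl]] _] := limit t Nt; exists l; split => //; split.
have wbar_lim t : ~ N t -> [/\ A (wbar t) (- B (wbar t)),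
    weakly_cvg dot (fun n => w n t) (wbar t) & B (w n t) @[n --> \oo] --> B (wbar t)].
  by have [_ [_]] := wbarP t.
exists wbar; split.
- apply: approximable_strongly_measurable.
  apply: (approximable_weakly_measurable dot_norm (x := x)) => [t e e0|j].
    by apply: L_x => //; case: (wbarP t).
  (* The weak limit of the iterates, sent to [0] on [N]. *)
  pose f n t := if t \in N then 0 else dot (w n t) (x j).
  apply: (measurable_fun_cvg (h := f)) => [n|t _].
    apply: measurable_fun_ifT => //; last first.
      by apply: approximable_dot => //; exact: approximable_cst.
    apply: (@measurable_fun_bool _ _ _ _ true) => //.
    by rewrite preimage_true setTI set_mem_set.
  rewrite /f; have [Nt|Nt] := pselect (N t).
    have [_ [/(_ Nt) -> _]] := wbarP t.
    by rewrite mem_set// (linear0l dot); exact: cvg_cst.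
  by rewrite memNset//; have [_ + _] := wbar_lim t Nt; apply.
- by apply: filterS aeN => t /wbar_lim[? _ _]; apply/zeros_of_sumP.
- by apply: filterS aeN => t /wbar_lim[].
- by apply: filterS aeN => t /wbar_lim[].
- move=> um; apply: filterS2 aeN um => t Nt um.
  have [_ _ Bw] := wbar_lim t Nt; have [_ [C wC]] := limit t Nt.
  exact: uniformly_monotone_strong_cvg dot_norm um wC Bw.
Qed.
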